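(* The mapping $$\Phi:\ w_1+\ell w_2\ \mapsto\ w_1^{-1}iw_1+\ell\,(w_1^{-1}w_2)$$ induces a diffeomorphism $\hat\Phi$ of $\mathbf M$ onto $\mathbf K$, given by $\hat\Phi(\pi(w_1,w_2))=\mathbb R_+\Phi(w_1+\ell w_2)$ for $(w_1,w_2)\in S^3\times S^3$. Moreover, the differential of this diffeomorphism transforms the ''no slipping, no twisting'' distribution $\mathbf D^3$ into the ''divisors of zero'' distribution $\mathbf\Delta$, that is, $\hat\Phi_*\mathbf D^3_{\mathbf m}=\mathbf\Delta_{\hat\Phi(\mathbf m)}$ for every $\mathbf m\in\mathbf M$.
   Context: Let $\mathbb H$ be the quaternions with the standard units $i,j,k$, and let $S^3=\{w\in\mathbb H: |w|=1\}$. The imaginary quaternions are identified with $\mathbb R^3$. **The space $\mathbf M$.** $\mathbf M$ is the 5-dimensional smooth manifold obtained as the quotient of $S^3\times S^3$ by the free action $(w_1,w_2)\mapsto(e^{i\theta}w_1,e^{i\theta}w_2)$, $\theta\in\mathbb R \bmod 2\pi$, and $\pi:S^3\times S^3\to\mathbf M$ is the canonical projection. **The distribution $\mathbf D^\rho$.** For $\rho>0$, the rank 2 distribution $\mathbf D^\rho$ on $\mathbf M$ is given by $$\mathbf D^\rho_{\pi(w_1,w_2)}=\pi_*\,\mathrm{span}_{\mathbb R}\{(jw_1,\rho jw_2),\,(kw_1,\rho kw_2)\},\qquad w_1,w_2\in S^3,$$ where $\pi_*$ is the differential of $\pi$ at $(w_1,w_2)$ and $(jw_1,\rho jw_2)$,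 $(kw_1,\rho kw_2)$ are tangent vectors to $S^3\times S^3$ at $(w_1,w_2)$. Equivalently, the spanned plane is $\{(zjw_1,\rho zjw_2): z\in\mathbb C\}$, with $\mathbb C=\mathbb R+\mathbb R i\subset\mathbb H$. Interpretation: $\mathbf M$ is a double covering of the space $M_{1,1}$ of orientation preserving isometries $\mu:T_{q_1}S^2\to T_{q_2}S^2$ between tangent planes of the unit sphere $S^2\subset\mathbb R^3$. The point $\pi(w_1,w_2)$ is sent to the isometry with $q_l=\bar w_liw_l$ $(l=1,2)$ and $\mu(\bar w_1jw_1)=\bar w_2jw_2$. The distribution $\mathbf D^\rho$ is the pullback to $\mathbf M$ of the distribution on $M_{1,1}$ whose integral curves $\mu(t):T_{q_1(t)}S^2\to T_{q_2(t)}S^2$ satisfy $\dot q_2=\rho\,\mu(\dot q_1)$ (rescaled no slipping condition) and send parallel vector fields along $q_1(t)$ to parallel vector fields along $q_2(t)$ (no twisting). This describes two balls whose radii are in ratio $\rho:1$ rolling on each other without slipping or twisting. **Split-octonions.** $\hat{\mathbb O}=\{w_1+\ell w_2: w_1,w_2\in\mathbb H\}$ is the real 8-dimensional algebra of split-octonions with multiplication $$(a+\ell b)(c+\ell d)=(ac+d\bar b)+\ell(\bar ad+cb).$$ For $x=w_1+\ell w_2$ put $\bar x=\bar w_1-\ell w_2$, so that $Q(x):=\bar xx=|w_1|^2-|w_2|^2$. Let $\mathbf Q(x,y)=\frac14(Q(x+y)-Q(x-y))$ be the polarization of $Q$. **The space $\mathbf K$.** Put $$\mathbb R^7=\{x\in\hat{\mathbb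 O}:\mathbf Q(1,x)=0\}=\{v_1+\ell v_2: v_1\in\mathbb R^3,\ v_2\in\mathbb H\},\qquad K=\{x\in\mathbb R^7: Q(x)=0\}.$$ The ''spherization'' of the cone $K$ is the 5-dimensional manifold $\mathbf K=\{\mathbb R_+x: x\in K\setminus 0\}$ of open rays in $K\setminus0$. It is identified with $\{v_1+\ell v_2: v_1\in\mathbb R^3,\ v_2\in\mathbb H,\ |v_1|=|v_2|=1\}=S^2\times S^3$. **The divisors of zero distribution $\mathbf\Delta$.** For $x\in K\setminus 0$ let $\Delta_x=\{y\in\mathbb R^7: xy=0\}$, a 3-dimensional subspace contained in $T_xK$ and containing $x$. For $\mathbf x=\mathbb R_+x$, $\mathbf\Delta_{\mathbf x}\subset T_{\mathbf x}\mathbf K$ is the 2-dimensional image of $\Delta_x$ under the differential at $x$ of the projection $K\setminus0\to\mathbf K$. This gives the rank 2 distribution $\mathbf\Delta=\{\mathbf\Delta_{\mathbf x}\}_{\mathbf x\in\mathbf K}$. *)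

(* Defs.v *)
From mathcomp Require Import all_boot all_order all_algebra.
From mathcomp Require Import generic_quotient.
From mathcomp Require Import all_classical all_reals all_analysis.
From mathcomp Require Import ring.

Set Implicit Arguments.
Unset Strict Implicit.
Unset Printing Implicit Defensive.

Import Order.TTheory GRing.Theory Num.Theory.
Import numFieldNormedType.Exports.

Local Open Scope classical_set_scope.
Local Open Scope ring_scope.
Local Open Scope quotient_scope.

Section Smooth.
Context {R : realType} {V W : normedModType R}.

(* In finite dimension, this is the usual C^k: a map is C^(k+1) on an open U
   iff it is differentiable on U and its directional derivatives are C^k. *)
Fixpoint Ck (k : nat) (U : set V) (f : V -> W) : Prop :=
  match k with
  | 0 => forall x, U x -> {for x, continuous f}
  | k'.+1 => (forall x, U x -> differentiable f x) /\
             (forall v, Ck k' U (fun x => 'D_v f x))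
  end.

Definition smooth_on (U : set V) (f : V -> W) : Prop := forall k, Ck k U f.

End Smooth.

(* Below, E is meant to be finite-dimensional and A an embedded submanifold of
   E; smoothness of a map on A means that it locally extends to a smooth map on
   an open subset of E. *)
Section Submanifold.
Context {R : realType} {E : normedModType R} (A : set E).

Definition smooth_extension {W : normedModType R} (f : A -> W) (x : A)
    (F : E -> W) : Prop :=
  exists U : set E, [/\ open U, U (\val x), smooth_on U F &
    forall y : A, U (\val y) -> F (\val y) = f y].

Definition smooth_at {W : normedModType R} (f : A -> W) (x : A) : Prop :=
  exists F, smooth_extension f x F.

(* Velocities at x of the smooth curves lying in A. *)
Definition tangent_at (x : A) : set E :=
  [set u | exists (e : R) (c : R^o -> E),
    [/\ 0 < e, smooth_on [set t : R^o | `|t| < e] c,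
        forall t, `|t| < e -> A (c t),
        c 0 = \val x & 'D_1 c 0 = u]].

(* The differential at x of a map f that is smooth at x; for a vector u
   tangent to A the value does not depend on the chosen extension. *)
Definition diff_at {W : normedModType R} (f : A -> W) (x : A) (u : E) : W :=
  'D_u (xget (fun=> 0) [set F | smooth_extension f x F]) (\val x).

End Submanifold.

Section Manifolds.
Context {R : realType}.

Record chart (T : Type) (n : nat) := Chart {
  cdom : set T;
  cmap : T -> 'rV[R]_n;
  cinv : 'rV[R]_n -> T
}.

Definition cimg (T : Type) n (c : chart T n) : set 'rV[R]_n :=
  cmap c @` cdom c.

Definition is_chart (T : topologicalType) n (c : chart T n) : Prop :=
  [/\ open (cdom c), open (cimg c),
      forall q, cdom c q -> cinv c (cmap c q) = q,
      {within cdom c, continuous (cmap c)} &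
      {within cimg c, continuous (cinv c)}].

Definition smooth_map (T1 T2 : Type) n1 n2 (A1 : set (chart T1 n1))
    (A2 : set (chart T2 n2)) (F : T1 -> T2) : Prop :=
  forall q, exists c1 c2, [/\ A1 c1 /\ cdom c1 q, A2 c2,
    F @` cdom c1 `<=` cdom c2 &
    smooth_on (cimg c1) (cmap c2 \o F \o cinv c1)].

Definition smooth_fun (T : Type) n (A : set (chart T n))
    (g : T -> R^o) : Prop :=
  forall q, exists c, [/\ A c, cdom c q & smooth_on (cimg c) (g \o cinv c)].

Definition diffeomorphism (T1 T2 : Type) n1 n2 (A1 : set (chart T1 n1))
    (A2 : set (chart T2 n2)) (F : T1 -> T2) : Prop :=
  smooth_map A1 A2 F /\
  exists G, [/\ cancel F G, cancel G F & smooth_map A2 A1 G].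

(* A tangent vector is represented by the derivation g |-> v g that it induces
   on smooth real functions, extended by 0 to the functions that are not
   smooth. *)
Definition tvector (T : Type) := (T -> R^o) -> R.

Definition differential (T1 T2 : Type) n2 (A2 : set (chart T2 n2))
    (F : T1 -> T2) (v : tvector T1) : tvector T2 :=
  fun g => if `[< smooth_fun A2 g >] then v (g \o F) else 0.

End Manifolds.

Section Quotient.
Context {R : realType} {E : normedModType R} {A : set E}.

(* The maximal atlas of the smooth structure of dimension n on Q for which
   the projection \pi_Q is a smooth submersion. *)
Definition quotient_atlas (Q0 : quotType A) (n : nat) :
    set (chart (quotient_topology Q0) n) :=
  let Q := quotient_topology Q0 in
  [set c | is_chart c /\
    forall x : A, cdom c (\pi_Q x) ->
      smooth_at (cmap c \o \pi_Q) x /\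
      diff_at (cmap c \o \pi_Q) x @` tangent_at x = [set: 'rV[R]_n]].

Arguments quotient_atlas Q0 n : clear implicits.

(* The image of the tangent vector u at x under the differential of \pi_Q. *)
Definition diff_pi (Q0 : quotType A) (n : nat) (x : A) (u : E) :
    tvector (quotient_topology Q0) :=
  fun g => if `[< smooth_fun (quotient_atlas Q0 n) g >]
           then diff_at (g \o \pi_(quotient_topology Q0)) x u else 0.

End Quotient.

Arguments quotient_atlas {R E A} Q0 n.
Arguments diff_pi {R E A} Q0 n x u.

Section Quaternions.
Context {R : realType}.

Definition quat (a b c d : R) : 'rV[R]_4 := \row_l [:: a; b; c; d]`_l.

Definition q1 := quat 1 0 0 0.
Definition qi := quat 0 1 0 0.
Definition qj := quat 0 0 1 0.
Definition qk := quat 0 0 0 1.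

Definition qmul (x y : 'rV[R]_4) : 'rV[R]_4 :=
  let: (a, b, c, d) := (x 0 0, x 0 1, x 0 2, x 0 3) in
  let: (a', b', c', d') := (y 0 0, y 0 1, y 0 2, y 0 3) in
  quat (a * a' - b * b' - c * c' - d * d')
       (a * b' + b * a' + c * d' - d * c')
       (a * c' - b * d' + c * a' + d * b')
       (a * d' + b * c' - c * b' + d * a').

Definition qconj (x : 'rV[R]_4) := quat (x 0 0) (- x 0 1) (- x 0 2) (- x 0 3).

Definition qabs (x : 'rV[R]_4) : R :=
  Num.sqrt (x 0 0 ^+ 2 + x 0 1 ^+ 2 + x 0 2 ^+ 2 + x 0 3 ^+ 2).

Definition qinv (x : 'rV[R]_4) := (qabs x ^- 2) *: qconj x.

Definition qexpi (t : R) := quat (cos t) (sin t) 0 0.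

Lemma quatE a b c d : (quat a b c d 0 0 = a) * (quat a b c d 0 1 = b) *
  (quat a b c d 0 2 = c) * (quat a b c d 0 3 = d).
Proof. by rewrite /quat !mxE. Qed.

Lemma quat_eq (x y : 'rV[R]_4) : x 0 0 = y 0 0 -> x 0 1 = y 0 1 ->
  x 0 2 = y 0 2 -> x 0 3 = y 0 3 -> x = y.
Proof.
move=> h0 h1 h2 h3; apply/rowP => -[[|[|[|[|//]]]] p].
- by move: h0; congr (x _ _ = y _ _); exact: val_inj.
- by move: h1; congr (x _ _ = y _ _); exact: val_inj.
- by move: h2; congr (x _ _ = y _ _); exact: val_inj.
- by move: h3; congr (x _ _ = y _ _); exact: val_inj.
Qed.

Lemma qabs2 (x : 'rV[R]_4) :
  qabs x ^+ 2 = x 0 0 ^+ 2 + x 0 1 ^+ 2 + x 0 2 ^+ 2 + x 0 3 ^+ 2.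
Proof. by rewrite sqr_sqrtr// !addr_ge0// sqr_ge0. Qed.

Lemma qabsM2 (x y : 'rV[R]_4) :
  qabs (qmul x y) ^+ 2 = qabs x ^+ 2 * qabs y ^+ 2.
Proof. by rewrite !qabs2 /qmul !quatE; ring. Qed.

Lemma qexpi0 (x : 'rV[R]_4) : qmul (qexpi 0) x = x.
Proof.
by apply: quat_eq; rewrite /qmul !quatE cos0 sin0; ring.
Qed.

Lemma qexpiD s t (x : 'rV[R]_4) :
  qmul (qexpi (s + t)) x = qmul (qexpi s) (qmul (qexpi t) x).
Proof.
by apply: quat_eq; rewrite /qmul !quatE cosD sinD; ring.
Qed.

End Quaternions.

(* The pair (w1, w2) also stands for the split-octonion w1 + l w2. *)
Definition HH (R : realType) : normedModType R :=
  ('rV[R]_4 * 'rV[R]_4)%type.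

Section Rolling.
Variable R : realType.

Definition S3S3 : set (HH R) := [set w | qabs w.1 = 1 /\ qabs w.2 = 1].

Definition circle_act (t : R) (w : HH R) : HH R :=
  (qmul (qexpi t) w.1, qmul (qexpi t) w.2).

Definition circle_rel : rel S3S3 := fun w w' =>
  `[< exists t, \val w' = circle_act t (\val w) >].

Lemma circle_rel_equiv : equiv_class_of circle_rel.
Proof.
split=> [w|w w'|w2 w1 w3].
- by apply/asboolP; exists 0; rewrite /circle_act !qexpi0; case: (\val w).
- apply/asbool_equiv_eq; split=> -[t e]; exists (- t);
    by rewrite e /circle_act -!qexpiD addNr !qexpi0; case: (\val _).
- move=> /asboolP[s es] /asboolP[t et]; apply/asboolP; exists (t + s).
  by rewrite et es /circle_act /= !qexpiD.
Qed.

Canonical circle_equiv := EquivRelPack circle_rel_equiv.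

Definition Mquot : quotType S3S3 := {eq_quot circle_equiv}.
Definition M : topologicalType := quotient_topology Mquot.

Definition atlasM : set (chart M 5) := quotient_atlas Mquot 5.

Definition rolling_vec (rho a b : R) (w : HH R) : HH R :=
  a *: ((qmul qj w.1, rho *: qmul qj w.2) : HH R) +
  b *: ((qmul qk w.1, rho *: qmul qk w.2) : HH R).

(* The plane does not depend on the representative w of m. *)
Definition D (rho : R) (m : M) : set (tvector M) :=
  [set v | exists w : S3S3, \pi_M w = m /\
     exists a b, v = diff_pi Mquot 5 w (rolling_vec rho a b (\val w))].

End Rolling.

Arguments S3S3 R : clear implicits.
Arguments atlasM R : clear implicits.

Section DivisorsOfZero.
Variable R : realType.

Definition omul (x y : HH R) : HH R :=
  (qmul x.1 y.1 + qmul y.2 (qconj x.2), qmul (qconj x.1) y.2 + qmul y.1 x.2).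

Definition oconj (x : HH R) : HH R := (qconj x.1, - x.2).

Definition o1 : HH R := (q1, 0).

Definition Q (x : HH R) : R := qabs x.1 ^+ 2 - qabs x.2 ^+ 2.

(* Q x is conj(x) x, which is real by the following lemma. *)
Lemma omul_conj x : omul (oconj x) x = Q x *: o1.
Proof.
rewrite /Q !qabs2; case: x => x y; congr pair; apply: quat_eq;
  by rewrite /= /qmul /qconj /q1 /quat !mxE /=; ring.
Qed.

Definition Qpol (x y : HH R) : R := 4^-1 * (Q (x + y) - Q (x - y)).

Lemma Qpol1 x : Qpol o1 x = x.1 0 0.
Proof.
by rewrite /Qpol /Q !qabs2 /= /q1 /quat !mxE /=; field.
Qed.

Definition R7 : set (HH R) := [set x | Qpol o1 x = 0].

Definition cone : set (HH R) := [set x | [/\ R7 x, Q x = 0 & x <> 0]].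

Definition ray_rel : rel cone := fun x y =>
  `[< exists r : R, 0 < r /\ \val y = r *: \val x >].

Lemma ray_rel_equiv : equiv_class_of ray_rel.
Proof.
split=> [x|x y|y x z].
- by apply/asboolP; exists 1; rewrite scale1r.
- apply/asbool_equiv_eq; split=> -[r [r0 e]]; exists r^-1; rewrite invr_gt0;
    by rewrite e scalerA mulVf ?scale1r ?gt_eqF.
- move=> /asboolP[r [r0 er]] /asboolP[s [s0 es]]; apply/asboolP; exists (s * r).
  by rewrite mulr_gt0// es er scalerA.
Qed.

Canonical ray_equiv := EquivRelPack ray_rel_equiv.

Definition Kquot : quotType cone := {eq_quot ray_equiv}.
Definition K : topologicalType := quotient_topology Kquot.

Definition atlasK : set (chart K 5) := quotient_atlas Kquot 5.

Definition Delta_at (x : HH R) : set (HH R) :=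
  [set y | R7 y /\ omul x y = 0].

Definition Delta (p : K) : set (tvector K) :=
  [set v | exists x : cone, \pi_K x = p /\
     exists2 y, Delta_at (\val x) y & v = diff_pi Kquot 5 x y].

End DivisorsOfZero.

Arguments cone R : clear implicits.
Arguments atlasK R : clear implicits.

Section Phi.
Variable R : realType.

Definition Phi (w : HH R) : HH R :=
  (qmul (qmul (qinv w.1) qi) w.1, qmul (qinv w.1) w.2).

Lemma cone_Phi (w : S3S3 R) : cone R (Phi (\val w)).
Proof.
case: w => -[w1 w2] /= /set_mem[/= h1 h2].
have hconj : qabs (qconj w1) ^+ 2 = 1.
  rewrite -[RHS](expr1n _ 2) -h1 !qabs2 /qconj /quat !mxE /=; ring.
have hi : qabs (qi : 'rV[R]_4) ^+ 2 = 1.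
  rewrite qabs2 /qi /quat !mxE /=; ring.
rewrite /Phi /qinv h1 expr1n invr1 scale1r /=; split.
- rewrite /R7 /= Qpol1 /= /qmul /qconj /qi /quat !mxE /=; ring.
- by rewrite /Q /= !qabsM2 hconj hi h1 h2 expr1n !mulr1 subrr.
- move=> [_ /(congr1 (fun x => qabs x ^+ 2))].
  rewrite qabsM2 hconj h2 expr1n mulr1 qabs2 !mxE => /eqP.
  by rewrite expr0n /= !addr0 oner_eq0.
Qed.

Definition PhiK (w : S3S3 R) : cone R := SigSub (mem_set (cone_Phi w)).

End Phi.

(* Main.v *)
Require Import Defs.
From HB Require Import structures.
From mathcomp Require Import all_boot all_order all_algebra.
From mathcomp Require Import generic_quotient.
From mathcomp Require Import all_classical all_reals all_analysis.
From mathcomp Require Import ring lra.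

Set Implicit Arguments.
Unset Strict Implicit.
Unset Printing Implicit Defensive.

Import Order.TTheory GRing.Theory Num.Theory.
Import numFieldNormedType.Exports.

Local Open Scope classical_set_scope.
Local Open Scope ring_scope.
Local Open Scope quotient_scope.

(* Write [Psi w] for (conj w1 i w1, conj w1 w2), a polynomial extension of Phi
   off S^3 x S^3. For imaginary p1, p2 the tangent vector (p1 w1, p2 w2) is mapped
   to (conj w1 [i, p1] w1, conj w1 (p2 - p1) w2), whereas the divisors of zero at
   Psi w are the (conj w1 i z w1, conj w1 z w2) with z orthogonal to i. For p1 in
   span(j, k) one has [i, p1] = 2 i p1, so that the two planes match (modulo the
   radial direction, given by z = 1) iff p2 - p1 = 2 p1: hence the ratio 3.

   Light-cone stereographic projections are charts of the spherized cone. The map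
   Phihat is a homeomorphism, its inverse being given locally by an explicit
   section of Phi, and the pullback by Phihat of any chart of K is a chart of M;
   read in such charts, Phihat and its inverse are the identity.

   Differentials are computed along curves of the form (r + al t) Psi (w(t)), where
   w(t) is the rational curve on S^3 x S^3 obtained from a Cayley transform. *)

(** * Smooth maps *)

Section Calculus.
Context {R : realType}.

Section Scale.
Context {W : normedModType R}.

Lemma scaler_is_bilinear :
  bilinear_for
    (GRing.Scale.Law.clone _ _ *:%R _) (GRing.Scale.Law.clone _ _ *:%R _)
    (@GRing.scale R W : R^o -> W -> W).
Proof.
split=> [u'|u] a x y /=.
- by rewrite scalerDl scalerA.
- by rewrite scalerDr !scalerA mulrC.
Qed.

(** Scaling is a continuous bilinear map on [R^o * W], so the product rule is the chain rule
    followed by the differential of a bilinear map. *)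
Lemma diff_scaler {V : normedModType R} (h : V -> R^o) (g : V -> W) (x : V) :
  differentiable h x -> differentiable g x ->
  differentiable (fun y => h y *: g y) x /\
  forall v, 'd (fun y => h y *: g y) x v = h x *: 'd g x v + 'd h x v *: g x.
Proof.
pose B0 := bilinear_isBilinear.Build R R^o W W _ _ _ scaler_is_bilinear.
pose B : {bilinear R^o -> W -> W} := HB.pack (@GRing.scale R W : R^o -> W -> W) B0.
have cB : continuous (fun p : R^o * W => B p.1 p.2) by exact: scale_continuous.
move=> dh dg.
have dp := differentiable_pair dh dg.
have dB : differentiable (fun p : R^o * W => B p.1 p.2) (h x, g x).
  exact: differentiable_bilin.
split; first exact: (differentiable_comp dp dB).
move=> v; rewrite -[LHS]/('d ((fun p : R^o * W => B p.1 p.2) \o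
  (fun y => (h y, g y))) x v) (diff_comp dp dB) /=.
by rewrite (diff_bilin (h x, g x) cB) (diff_pair dh dg).
Qed.

End Scale.

Lemma derive_comp {V V' W : normedModType R} (f : V -> V') (g : V' -> W) x v :
  differentiable f x -> differentiable g (f x) ->
  'D_v (g \o f) x = 'D_('D_v f x) g (f x).
Proof.
move=> df dg; rewrite !deriveE//; last exact: differentiable_comp.
by rewrite diff_comp.
Qed.

Lemma Ck_continuous {V W : normedModType R} k (U : set V) (f : V -> W) :
  Ck k U f -> forall x, U x -> {for x, continuous f}.
Proof.
case: k => [//|k] [df _] x Ux; exact/differentiable_continuous/df.
Qed.

Lemma CkS {V W : normedModType R} k (U : set V) (f : V -> W) :
  Ck k.+1 U f -> Ck k U f.
Proof.
elim: k f => [|k IH] f [df Df]; first exact: Ck_continuous (conj df Df : Ck 1 U f).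
by split=> // v; exact/IH/Df.
Qed.

(** The expansion of f at x depends only on the germ of f, so ['d f x] also expands g; [diff_unique]
    then identifies it with ['d g x]. *)
Lemma near_eq_differentiable {V W : normedModType R} (f g : V -> W) x :
  (\near x, f x = g x) -> differentiable f x -> differentiable g x.
Proof.
move=> fg df; have [cdf /eqaddoP dfE] := (diff_locallyP _ _).1 df.
have dgE : g \o shift x = cst (g x) + 'd f x +o_ (nbhs 0) id.
  have fg0 : \forall h \near 0, f (h + x) = g (h + x).
    by move: fg; rewrite (near_shift 0) subr0.
  apply/eqaddoP => e e0; apply: filterS2 fg0 (dfE e e0) => h /=.
  by rewrite !fctE /= (nbhs_singleton fg) => ->.
by apply/diff_locallyP; rewrite (diff_unique cdf dgE).
Qed.

(** The functions inside [Ck] live on the whole space, while formulas for their derivatives hold on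
    U only. Openness of U lets such formulas be substituted at every order. *)
Lemma Ck_eq {V W : normedModType R} k (U : set V) (f g : V -> W) :
  open U -> (forall x, U x -> f x = g x) -> Ck k U f -> Ck k U g.
Proof.
move=> oU; elim: k f g => [|k IH] f g fg.
  move=> cf x Ux; have cfx : f @ x --> f x := cf x Ux.
  rewrite (_ : {for x, continuous g} = (g @ x --> g x))// -(fg x Ux).
  apply: cvg_trans cfx.
  apply: near_eq_cvg; have : \forall y \near x, U y by exact: open_nbhs_nbhs (conj oU Ux).
  by apply: filterS => y Uy; rewrite (fg y Uy).
have fgx x : U x -> \forall y \near x, f y = g y.
  move=> Ux; have : \forall y \near x, U y by exact: open_nbhs_nbhs (conj oU Ux).
  by apply: filterS => y; exact: fg.
move=> [df Df]; split=> [x Ux|v].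
  exact/(near_eq_differentiable (fgx x Ux))/df.
apply: IH (Df v) => x Ux; exact/near_eq_derive/fgx.
Qed.

Lemma Ck_sub {V W : normedModType R} k (U U' : set V) (f : V -> W) :
  U' `<=` U -> Ck k U f -> Ck k U' f.
Proof.
move=> UU; elim: k f => [|k IH] f; first by move=> cf x /UU; exact: cf.
by move=> [df Df]; split=> [x /UU/df//|v]; exact/IH/Df.
Qed.

Lemma Ck_cst {V W : normedModType R} k (U : set V) (a : W) :
  Ck k U (fun=> a).
Proof.
elim: k a => [|k IH] a; first by move=> x _; exact: cst_continuous.
split=> [x _|v]; first exact: differentiable_cst.
have -> : (fun x => 'D_v (fun=> a) x) = (fun=> 0 : W); last exact: IH.
by apply/funext => x; exact: derive_cst.
Qed.

Lemma Ck_linear {V W : normedModType R} k (U : set V) (f : {linear V -> W}) :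
  continuous f -> Ck k U f.
Proof.
move=> cf; have df x : differentiable f x by exact: linear_differentiable.
case: k => [|k]; first by move=> x _; exact: cf.
split=> [x _//|v].
have -> : (fun x => 'D_v f x) = (fun=> f v); last exact: Ck_cst.
by apply/funext => x; rewrite deriveE// diff_lin.
Qed.

Lemma Ck_linear_comp {V W W' : normedModType R} k (U : set V)
    (L : {linear W -> W'}) (f : V -> W) : open U ->
  continuous L -> Ck k U f -> Ck k U (L \o f).
Proof.
move=> oU cL; elim: k f => [|k IH] f.
  by move=> cf x Ux; apply: continuous_comp; [exact: cf|exact: cL].
have dL x : differentiable L x by exact: linear_differentiable.
move=> [df Df]; split=> [x Ux|v].
  by apply: differentiable_comp; [exact: df|exact: dL].
apply: Ck_eq (IH _ (Df v)) => // x Ux /=.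
rewrite (derive_comp _ (df x Ux))// [RHS]deriveE//.
by rewrite (diff_lin _ cL).
Qed.

Lemma CkD {V W : normedModType R} k (U : set V) (f g : V -> W) :
  open U -> Ck k U f -> Ck k U g -> Ck k U (fun x => f x + g x).
Proof.
move=> oU; elim: k f g => [|k IH] f g.
  by move=> cf cg x Ux; apply: continuousD; [exact: cf|exact: cg].
move=> [df Df] [dg Dg]; split=> [x Ux|v].
  by apply: differentiableD; [exact: df|exact: dg].
apply: Ck_eq (IH _ _ (Df v) (Dg v)) => // x Ux.
by rewrite -deriveD//; apply: diff_derivable; [exact: df|exact: dg].
Qed.

Lemma Ck_scale {V W : normedModType R} k (U : set V) (h : V -> R^o) (g : V -> W) :
  open U -> Ck k U h -> Ck k U g -> Ck k U (fun x => h x *: g x).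
Proof.
move=> oU; elim: k h g => [|k IH] h g.
  by move=> ch cg x Ux; apply: continuousZ; [exact: ch|exact: cg].
move=> Ch Cg; have [dh Dh] := Ch; have [dg Dg] := Cg; split=> [x Ux|v].
  by have [] := diff_scaler (dh x Ux) (dg x Ux).
have /= := CkD oU (IH _ _ (CkS Ch) (Dg v)) (IH _ _ (Dh v) (CkS Cg)).
apply: Ck_eq => // x Ux.
have [d e] := diff_scaler (dh x Ux) (dg x Ux).
by rewrite (deriveE v d) e (deriveE v (dh x Ux)) (deriveE v (dg x Ux)).
Qed.

(** The derivative of 1/h is - (1/h)^2 times that of h, and the induction hypothesis applies to 1/h
    itself. *)
Lemma Ck_inv {V : normedModType R} k (U : set V) (h : V -> R^o) :
  open U -> (forall x, U x -> h x != 0) -> Ck k U h ->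
  Ck k U (fun x => (h x)^-1 : R^o).
Proof.
move=> oU h0; elim: k => [|k IH].
  by move=> ch x Ux; apply: continuousV; [exact: h0|exact: ch].
move=> Ch; have [dh Dh] := Ch; split=> [x Ux|v].
  by apply: (differentiableV (dh x Ux)); exact: h0.
have IH' := IH (CkS Ch).
have := Ck_scale oU (Ck_scale oU IH' IH') (Ck_scale oU (Ck_cst k U (-1 : R^o)) (Dh v)).
apply: Ck_eq => // x Ux /=.
rewrite deriveV; [|exact: h0|exact/diff_derivable/dh].
by rewrite -exprVn expr2 scaleN1r scalerN scaleNr.
Qed.

Section Composition.
Context {V W : normedModType R}.

(* Finite-dimensionality of V', in the form in which the chain rule for
   iterated directional derivatives needs it. *)
Definition coordinatized (V' : normedModType R) : Prop :=
  exists n, exists (L : 'I_n -> {linear V' -> R^o}) (e : 'I_n -> V'),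
    (forall i, continuous (L i)) /\ forall y, y = \sum_(i < n) L i y *: e i.

Lemma Ck_sum n k (U : set V) (f : 'I_n -> V -> W) : open U ->
  (forall i, Ck k U (f i)) -> Ck k U (fun x => \sum_(i < n) f i x).
Proof.
move=> oU; elim: n f => [|n IH] f Cf.
  by under eq_fun do rewrite big_ord0; exact: Ck_cst.
under eq_fun do rewrite big_ord_recr /=.
by apply: CkD => //; apply: IH.
Qed.

(** By the chain rule g is differentiated in the direction ['D_v f x], which moves with x. Expanding
    it in the fixed vectors [e i] leaves products of scalar functions with ['D_(e i) g \o f], which
    the induction hypothesis covers. *)
Lemma Ck_comp (V' : normedModType R) k (U : set V) (U' : set V')
    (f : V -> V') (g : V' -> W) :
  coordinatized V' -> open U -> (forall x, U x -> U' (f x)) ->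
  Ck k U f -> Ck k U' g -> Ck k U (g \o f).
Proof.
move=> [n [L [e [cL Le]]]] oU UU'; elim: k g => [|k IH] g.
  move=> cf cg x Ux; apply: continuous_comp; first exact: cf.
  exact/cg/UU'.
move=> Cf; have [df Df] := Cf; move=> [dg Dg]; split=> [x Ux|v].
  by apply: differentiable_comp; [exact: df|exact/dg/UU'].
have C i : Ck k U (fun x => L i ('D_v f x) *: 'D_(e i) g (f x)).
  apply: Ck_scale => //; first exact: Ck_linear_comp (cL i) (Df v).
  exact: IH (CkS Cf) (Dg (e i)).
apply: Ck_eq (Ck_sum oU C) => // x Ux.
have dgx : differentiable g (f x) by exact/dg/UU'.
rewrite (derive_comp _ (df x Ux))// [RHS]deriveE// [in RHS](Le ('D_v f x)).
rewrite linear_sum; apply: eq_bigr => i _; by rewrite linearZ (deriveE (e i) dgx).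
Qed.

End Composition.
End Calculus.

Section Smooth.
Context {R : realType}.

Lemma derive_pair {V W W' : normedModType R} (f : V -> W) (g : V -> W') x v :
  differentiable f x -> differentiable g x ->
  'D_v (fun x => (f x, g x)) x = ('D_v f x, 'D_v g x).
Proof.
move=> df dg; rewrite !deriveE//; last exact: differentiable_pair.
by rewrite (diff_pair df dg).
Qed.

Lemma Ck_pair {V W W' : normedModType R} k (U : set V) (f : V -> W)
    (g : V -> W') : open U -> Ck k U f -> Ck k U g ->
  Ck k U (fun x => (f x, g x)).
Proof.
move=> oU; elim: k f g => [|k IH] f g.
  by move=> cf cg x Ux; apply: cvg_pair; [exact: cf|exact: cg].
move=> [df Df] [dg Dg]; split=> [x Ux|v].
  by apply: differentiable_pair; [exact: df|exact: dg].
apply: Ck_eq (IH _ _ (Df v) (Dg v)) => // x Ux.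
by rewrite (derive_pair _ (df x Ux) (dg x Ux)).
Qed.

Lemma smooth_sub {V W : normedModType R} (U' U : set V) (f : V -> W) :
  U' `<=` U -> smooth_on U f -> smooth_on U' f.
Proof. by move=> UU sf k; exact: Ck_sub (sf k). Qed.

Section Coordinates.
Context {V : normedModType R}.
Variable U : set V.
Hypothesis oU : open U.

Lemma smooth_cst {W : normedModType R} (a : W) : smooth_on U (fun=> a).
Proof. by move=> k; exact: Ck_cst. Qed.

Lemma smooth_continuous {W : normedModType R} (f : V -> W) x :
  smooth_on U f -> U x -> f @ x --> f x.
Proof. by move=> sf Ux; exact: (sf 0%N x Ux). Qed.

Lemma smooth_linear {W : normedModType R} (f : {linear V -> W}) :
  continuous f -> smooth_on U f.
Proof. by move=> cf k; exact: Ck_linear. Qed.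

Lemma smooth_linear_comp {W W' : normedModType R} (L : {linear W -> W'})
  (f : V -> W) : continuous L -> smooth_on U f -> smooth_on U (L \o f).
Proof. by move=> cL sf k; exact: Ck_linear_comp. Qed.

Lemma smoothD {W : normedModType R} (f g : V -> W) :
  smooth_on U f -> smooth_on U g -> smooth_on U (fun x => f x + g x).
Proof. by move=> sf sg k; exact: CkD. Qed.

Lemma smoothZ {W : normedModType R} (h : V -> R^o) (g : V -> W) :
  smooth_on U h -> smooth_on U g -> smooth_on U (fun x => h x *: g x).
Proof. by move=> sf sg k; exact: Ck_scale. Qed.

Lemma smoothM (f g : V -> R^o) :
  smooth_on U f -> smooth_on U g -> smooth_on U (fun x => f x * g x : R^o).
Proof. exact: smoothZ. Qed.

Lemma smoothN (f : V -> R^o) :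
  smooth_on U f -> smooth_on U (fun x => - f x : R^o).
Proof.
move=> sf; under eq_fun do rewrite -mulN1r.
by apply: smoothM => //; exact: smooth_cst.
Qed.

Lemma smoothB (f g : V -> R^o) :
  smooth_on U f -> smooth_on U g -> smooth_on U (fun x => f x - g x : R^o).
Proof. by move=> sf sg; apply: smoothD => //; exact: smoothN. Qed.

Lemma smoothX (f : V -> R^o) n :
  smooth_on U f -> smooth_on U (fun x => f x ^+ n : R^o).
Proof.
move=> sf; elim: n => [|n IH]; first exact: smooth_cst.
by under eq_fun do rewrite exprS; exact: smoothM.
Qed.

Lemma smoothV (f : V -> R^o) : (forall x, U x -> f x != 0) ->
  smooth_on U f -> smooth_on U (fun x => (f x)^-1 : R^o).
Proof. by move=> f0 sf k; exact: Ck_inv. Qed.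

Lemma smooth_pair {W W' : normedModType R} (f : V -> W) (g : V -> W') :
  smooth_on U f -> smooth_on U g -> smooth_on U (fun x => (f x, g x)).
Proof. by move=> sf sg k; exact: Ck_pair. Qed.

Lemma smooth_fst {W W' : normedModType R} (f : V -> W * W') :
  smooth_on U f -> smooth_on U (fun x => (f x).1).
Proof.
move=> sf; apply: (smooth_linear_comp (L := fst : {linear (W * W')%type -> W})) => //.
by move=> x; exact: cvg_fst.
Qed.

Lemma smooth_snd {W W' : normedModType R} (f : V -> W * W') :
  smooth_on U f -> smooth_on U (fun x => (f x).2).
Proof.
move=> sf; apply: (smooth_linear_comp (L := snd : {linear (W * W')%type -> W'})) => //.
by move=> x; exact: cvg_snd.
Qed.

End Coordinates.

Definition rcoord n (i : 'I_n) (x : 'rV[R]_n) : R^o := x 0 i.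

Lemma rcoord_is_linear n i : linear (@rcoord n i).
Proof. by move=> a x y; rewrite /rcoord !mxE. Qed.

HB.instance Definition _ n i :=
  GRing.isLinear.Build R 'rV[R]_n R^o _ (@rcoord n i) (@rcoord_is_linear n i).

Lemma rcoord_continuous n i : continuous (@rcoord n i).
Proof. exact: coord_continuous. Qed.

Section Rows.
Context {V : normedModType R}.
Variable U : set V.
Hypothesis oU : open U.

Lemma smooth_coord n (f : V -> 'rV[R]_n) i :
  smooth_on U f -> smooth_on U (fun x => f x 0 i : R^o).
Proof.
by move=> sf; apply: (smooth_linear_comp oU (L := @rcoord n i)) => //;
  exact: rcoord_continuous.
Qed.

Lemma smooth_row n (f : V -> 'rV[R]_n) :
  (forall i, smooth_on U (fun x => f x 0 i : R^o)) -> smooth_on U f.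
Proof.
move=> sf k.
have -> : f = fun x => \sum_(i < n) (f x 0 i : R^o) *: delta_mx 0 i.
  by apply/funext => x; exact: row_sum_delta.
apply: Ck_sum => // i; apply: Ck_scale => //; [exact: sf|exact: Ck_cst].
Qed.

End Rows.

Lemma coordinatized_row n : coordinatized ('rV[R]_n : normedModType R).
Proof.
exists n, (@rcoord n), (fun i => delta_mx 0 i); split=> [i|y].
  exact: rcoord_continuous.
exact: row_sum_delta.
Qed.

Lemma coordinatized_prod (V W : normedModType R) :
  coordinatized V -> coordinatized W -> coordinatized (V * W : normedModType R)%type.
Proof.
move=> [n [L [e [cL Le]]]] [m [L' [e' [cL' Le']]]].
exists (n + m)%N,
  (fun i => match fintype.split i with
            | inl j => (L j \o fst : {linear (V * W)%type -> R^o})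
            | inr j => (L' j \o snd : {linear (V * W)%type -> R^o})
            end),
  (fun i => match fintype.split i with inl j => (e j, 0) | inr j => (0, e' j) end).
split=> [i|[y z]].
  by case: (fintype.split i) => j p; apply: continuous_comp;
    [exact: cvg_fst|exact: cL|exact: cvg_snd|exact: cL'].
rewrite big_split_ord /=.
under eq_bigr do rewrite (unsplitK (inl _)) /=.
under [X in _ + X]eq_bigr do rewrite (unsplitK (inr _)) /=.
have -> : \sum_(i < n) L i y *: (e i, 0 : W) = (y, 0).
  rewrite [in RHS](Le y); elim/big_ind2 : _ => //= [? ? ? ? -> ->|i _].
    by congr pair; rewrite addr0.
  by congr pair; rewrite scaler0.
have -> : \sum_(i < m) L' i z *: (0 : V, e' i) = (0, z).
  rewrite [in RHS](Le' z); elim/big_ind2 : _ => //= [? ? ? ? -> ->|i _].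
    by congr pair; rewrite addr0.
  by congr pair; rewrite scaler0.
by congr pair; rewrite /= ?addr0 ?add0r.
Qed.

Lemma coordinatized_HH : coordinatized (HH R).
Proof. by apply: coordinatized_prod; exact: coordinatized_row. Qed.

(** The difference quotient is [b + h *: c h], so continuity of c at 0 is enough. Derivatives of
    polynomial and rational maps are computed in this way from exact expansions. *)
Lemma derive_expansion {V W : normedModType R} (f : V -> W) x v b
    (c : R^o -> W) :
  (forall h : R, f (h *: v + x) = f x + h *: b + h ^+ 2 *: c h) ->
  c @ (0 : R^o) --> c 0 -> 'D_v f x = b.
Proof.
move=> fE cc; apply: cvg_lim => //.
have : (b + h *: c h) @[h --> 0^'] --> b.
  rewrite -[X in _ --> X](addr0 b) -[X in _ --> b + X](scale0r (c 0)).
  apply: cvgD; first exact: cvg_cst.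
  apply: cvgZ; apply: cvg_within_filter; [exact: cvg_id|exact: cc].
apply: cvg_trans; apply: near_eq_cvg; near=> h.
have h0 : h != 0 by near: h; exact: nbhs_dnbhs_neq.
rewrite /= fE (_ : _ - f x = h *: b + h ^+ 2 *: c h); last first.
  by rewrite -[X in X - _]addrA addrAC subrr add0r.
rewrite scalerDr !scalerA mulVf// scale1r.
by rewrite expr2 mulKf.
Unshelve. all: by end_near. Qed.

(** * Smooth maps on subsets and their differentials along curves *)

Section Submanifolds.
Context {E W : normedModType R}.

(** The clauses of [tangent_at] with the curve and its radius exposed, so that a differential can be
    evaluated along a given curve. *)
Definition curve_on (A : set E) (x : A) (e : R) (c : R^o -> E) (u : E) :=
  [/\ 0 < e, smooth_on [set t : R^o | `|t| < e] c,
      forall t, `|t| < e -> A (c t), c 0 = \val x & 'D_1 c 0 = u].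

Lemma open_norm_lt (e : R) : open [set t : R^o | `|t| < e].
Proof.
have -> : [set t : R^o | `|t| < e] = (fun t : R^o => `|t|) @^-1` [set s | s < e].
  by [].
by apply: open_comp => [t _|]; [exact: norm_continuous|exact: open_lt].
Qed.

Lemma near_norm_lt (e : R) : 0 < e -> \forall t \near (0 : R^o), `|t| < e.
Proof.
move=> e0; apply: (open_nbhs_nbhs (A := [set t : R^o | `|t| < e])).
by split; [exact: open_norm_lt|rewrite /= normr0].
Qed.

(** Any smooth extension F of f agrees with f along the curve near 0, so the chain rule gives the
    same value whichever F is picked. The function h stands for f along c, because f takes arguments
    in the subtype of A and c has values in E. *)
Lemma diff_at_curve (A : set E) (f : A -> W) (x : A) e c u (h : R^o -> W) :
  smooth_at f x -> curve_on x e c u ->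
  (forall t (y : A), `|t| < e -> \val y = c t -> h t = f y) ->
  diff_at f x u = 'D_1 h 0.
Proof.
move=> sf [e0 sc Ac c0 cu] hf; rewrite /diff_at.
(* Smoothness of f at x excludes the default value of [xget]. *)
case: xgetP => [F _|/forallNP/= nF]; last by case: nF; exact: sf.
move=> [U [oU Ux sF FE]].
have dF : differentiable F (c 0) by rewrite c0; apply: (sF 1%N).1.
have dc : differentiable c 0 by apply: (sc 1%N).1; rewrite /= normr0.
rewrite -c0 -cu -derive_comp//; apply: near_eq_derive.
have Uc : \forall t \near (0 : R^o), U (c t).
  apply: (differentiable_continuous dc); apply: open_nbhs_nbhs.
  by split; rewrite ?c0.
apply: filterS2 Uc (near_norm_lt e0) => t Uct te /=.
by rewrite (hf t (SigSub (mem_set (Ac t te))))// -FE.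
Qed.

(** The domain is cut down to the points that F sends into V, and to O, where k factors through f.
    This serves functions read in a chart, which factor only over the domain of the chart. *)
Lemma smooth_at_post (W' : normedModType R) (A : set E) (f : A -> W) (x : A)
    (V : set W) (G : W -> W') (k : A -> W') (O : set E) :
  coordinatized W -> smooth_at f x -> open V -> V (f x) -> smooth_on V G ->
  open O -> O (\val x) -> (forall y : A, O (\val y) -> k y = G (f y)) ->
  smooth_at k x.
Proof.
move=> cW [F [U [oU Ux sF FE]]] oV Vfx sG oO Ox kE.
have oUV : open (U `&` F @^-1` V).
  rewrite openE => y [Uy Vy]; apply: filterI.
    exact: open_nbhs_nbhs.
  by apply: (Ck_continuous (sF 0%N) Uy); exact: open_nbhs_nbhs.
exists (G \o F), (O `&` (U `&` F @^-1` V)); split.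
- exact: openI.
- by split=> //; split=> //=; rewrite FE.
- move=> n; apply: (Ck_comp cW (U' := V)) => //; first exact: openI.
  + by move=> y [_ []].
  + by apply: Ck_sub (sF n) => y [_ []].
- by move=> y [Oy [Uy _]]; rewrite kE//= FE.
Qed.

Lemma smooth_at_pre (E' : normedModType R) (A : set E) (B : set E')
    (f : A -> W) (G : E' -> E) (g : B -> A) (x : B) :
  coordinatized E -> smooth_on setT G -> (forall y, \val (g y) = G (\val y)) ->
  smooth_at f (g x) -> smooth_at (f \o g) x.
Proof.
move=> cE sG gG [F [U [oU Ux sF FE]]].
have oV : open (G @^-1` U).
  by apply: open_comp => // y _; exact: (Ck_continuous (sG 0%N)).
exists (F \o G), (G @^-1` U); split=> //.
- by rewrite /= -gG.
- move=> n; apply: (Ck_comp cE (U' := U)) => //.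
  exact: Ck_sub (sG n).
- by move=> y /=; rewrite -gG => /FE.
Qed.

End Submanifolds.
End Smooth.

(** * Quaternions *)

Section QuaternionAlgebra.
Context {R : realType}.
Implicit Types x y z w g h p v u : 'rV[R]_4.

Definition qdot x y : R :=
  x 0 0 * y 0 0 + x 0 1 * y 0 1 + x 0 2 * y 0 2 + x 0 3 * y 0 3.

Lemma qabs2E x : qabs x ^+ 2 = qdot x x.
Proof. by rewrite qabs2 !expr2. Qed.

Ltac qring := apply: quat_eq;
  rewrite /qdot /qmul /qconj /q1 /qi /qj /qk !(quatE, mxE); ring.

Lemma qmulA x y z : qmul x (qmul y z) = qmul (qmul x y) z.
Proof. by qring. Qed.

Lemma qmul1 x : qmul q1 x = x. Proof. by qring. Qed.
Lemma qmulr1 x : qmul x q1 = x. Proof. by qring. Qed.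

Lemma qmulDl x y z : qmul (x + y) z = qmul x z + qmul y z.
Proof. by qring. Qed.

Lemma qmulDr x y z : qmul z (x + y) = qmul z x + qmul z y.
Proof. by qring. Qed.

Lemma qmulZl a x y : qmul (a *: x) y = a *: qmul x y.
Proof. by qring. Qed.

Lemma qmulZr a x y : qmul x (a *: y) = a *: qmul x y.
Proof. by qring. Qed.

Lemma qmulNl x y : qmul (- x) y = - qmul x y.
Proof. by qring. Qed.

Lemma qmulNr x y : qmul x (- y) = - qmul x y.
Proof. by qring. Qed.

Lemma qconjM x y : qconj (qmul x y) = qmul (qconj y) (qconj x).
Proof. by qring. Qed.

Lemma qconjK x : qconj (qconj x) = x. Proof. by qring. Qed.

Lemma qconjD x y : qconj (x + y) = qconj x + qconj y.
Proof. by qring. Qed.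

Lemma qconjZ a x : qconj (a *: x) = a *: qconj x.
Proof. by qring. Qed.

Lemma qconj_im p : p 0 0 = 0 -> qconj p = - p.
Proof. by move=> p0; apply: quat_eq; rewrite /qconj !(quatE, mxE) ?p0; ring. Qed.

Lemma qmul_conj x : qmul x (qconj x) = qdot x x *: q1.
Proof. by qring. Qed.

Lemma qconj_mul x : qmul (qconj x) x = qdot x x *: q1.
Proof. by qring. Qed.

Lemma qdotM x y : qdot (qmul x y) (qmul x y) = qdot x x * qdot y y.
Proof. by rewrite -!qabs2E qabsM2. Qed.

Lemma qdot_conj x : qdot (qconj x) (qconj x) = qdot x x.
Proof. by rewrite /qdot /qconj !quatE; ring. Qed.

Lemma qdotZ a b x y : qdot (a *: x) (b *: y) = a * b * qdot x y.
Proof. by rewrite /qdot !mxE; ring. Qed.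

Lemma qdot_eq0 x : (qdot x x == 0) = (x == 0).
Proof.
apply/eqP/eqP => [|->]; last by rewrite /qdot !mxE; ring.
rewrite /qdot -!expr2 => /eqP; rewrite !paddr_eq0 ?addr_ge0 ?sqr_ge0//.
rewrite !sqrf_eq0 => /andP[/andP[/andP[/eqP ? /eqP ?] /eqP ?] /eqP ?].
by apply: quat_eq; rewrite mxE.
Qed.

Lemma qdot_ge0 x : 0 <= qdot x x.
Proof. by rewrite -qabs2E sqr_ge0. Qed.

Lemma qabs1P x : qabs x = 1 <-> qdot x x = 1.
Proof.
rewrite -qabs2E; split=> [->|/eqP]; first by rewrite expr1n.
by rewrite sqrf_eq1 => /orP[/eqP//|/eqP x1]; have := sqrtr_ge0
  (x 0 0 ^+ 2 + x 0 1 ^+ 2 + x 0 2 ^+ 2 + x 0 3 ^+ 2);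
  rewrite -/(qabs x) x1 oppr_ge0 ler10.
Qed.

Lemma unit_qmul_conj w : qdot w w = 1 -> qmul w (qconj w) = q1.
Proof. by move=> w1; rewrite qmul_conj w1 scale1r. Qed.

Lemma unit_qconj_mul w : qdot w w = 1 -> qmul (qconj w) w = q1.
Proof. by move=> w1; rewrite qconj_mul w1 scale1r. Qed.

Lemma unit_qmulK w x : qdot w w = 1 -> qmul (qmul x w) (qconj w) = x.
Proof. by move=> w1; rewrite -qmulA unit_qmul_conj// qmulr1. Qed.

Lemma unit_qmulVK w x : qdot w w = 1 -> qmul (qmul x (qconj w)) w = x.
Proof. by move=> w1; rewrite -qmulA unit_qconj_mul// qmulr1. Qed.

Lemma unit_qKmul w x : qdot w w = 1 -> qmul (qconj w) (qmul w x) = x.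
Proof. by move=> w1; rewrite qmulA unit_qconj_mul// qmul1. Qed.

Lemma unit_qVKmul w x : qdot w w = 1 -> qmul w (qmul (qconj w) x) = x.
Proof. by move=> w1; rewrite qmulA unit_qmul_conj// qmul1. Qed.

Lemma qmul_ii x : qmul qi (qmul qi x) = - x.
Proof. by qring. Qed.

Lemma qconj_i : qconj qi = - qi :> 'rV[R]_4.
Proof. by qring. Qed.

Lemma qdot_i : qdot qi qi = 1 :> R.
Proof. by rewrite /qdot /qi !quatE; ring. Qed.

(** The second argument of [qdot] is the second component of [Psi (w, w')], and in [im_i_conjugate]
    it is the first one. Tangency conditions on the cone thus become the vanishing of
    coordinates. *)
Lemma re_qmulC x w w' : (qmul (qmul w x) (qconj w')) 0 0 = qdot x (qmul (qconj w) w').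
Proof. by rewrite /qdot /qmul /qconj !quatE; ring. Qed.

Lemma re_conjugate x w : (qmul (qmul w x) (qconj w)) 0 0 = qdot w w * x 0 0.
Proof. by rewrite /qdot /qmul /qconj !quatE; ring. Qed.

Lemma re_conjugateV x w : (qmul (qmul (qconj w) x) w) 0 0 = qdot w w * x 0 0.
Proof. by rewrite /qdot /qmul /qconj !quatE; ring. Qed.

Lemma im_i_conjugate x w :
  (qmul (qmul w x) (qconj w)) 0 1 = qdot x (qmul (qmul (qconj w) qi) w).
Proof. by rewrite /qdot /qmul /qconj /qi !quatE; ring. Qed.

(* If v^2 = -1, then h = g - i g v satisfies h v = i h. *)
Lemma conjugate_qi_section g v : v 0 0 = 0 -> qdot v v = 1 ->
  let h := g - qmul (qmul qi g) v in
  qmul (qmul (qconj h) qi) h = qdot h h *: v.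
Proof.
move=> v0 v1 h.
have vv : qmul v v = - q1.
  by rewrite -[X in qmul X _]opprK -(qconj_im v0) qmulNl unit_qconj_mul.
have hv : qmul h v = qmul qi h.
  rewrite /h qmulDl qmulNl -qmulA vv qmulNr qmulr1 opprK qmulDr qmulNr.
  by rewrite -(qmulA qi g v) qmul_ii opprK addrC.
by rewrite -qmulA -hv qmulA qconj_mul qmulZl qmul1.
Qed.

Lemma comm_qi x : qmul qi x = qmul x qi -> x 0 2 = 0 /\ x 0 3 = 0.
Proof.
move=> e; have := congr1 (fun y => y 0 2) e; have := congr1 (fun y => y 0 3) e.
by rewrite /qmul /qi !quatE; split; lra.
Qed.

(** [acos] recovers the angle up to sign, which the sign of the i-coordinate then fixes. *)
Lemma unit_qexpi x : x 0 2 = 0 -> x 0 3 = 0 -> qdot x x = 1 ->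
  exists t, x = qexpi t.
Proof.
move=> x2 x3; rewrite /qdot x2 x3 !mulr0 !addr0 => x1.
have a1 : -1 <= x 0 0 <= 1.
  by have := sqr_ge0 (x 0 1); rewrite expr2 => ?; apply/andP; split; nra.
have sa : sin (acos (x 0 0)) = `|x 0 1|.
  by rewrite sin_acos// -sqrtr_sqr; congr Num.sqrt; rewrite !expr2 -x1; ring.
have ca : cos (acos (x 0 0)) = x 0 0 by rewrite acosK ?in_itv.
have [b0|b0] := lerP 0 (x 0 1).
  exists (acos (x 0 0)); rewrite /qexpi sa ca ger0_norm//.
  by apply: quat_eq; rewrite !quatE.
exists (- acos (x 0 0)); rewrite /qexpi sinN cosN sa ca ltr0_norm// opprK.
by apply: quat_eq; rewrite !quatE.
Qed.

End QuaternionAlgebra.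

(** * The map Phi and its differential *)

Section Rolling.
Context {R : realType}.
Implicit Types (w x y u : HH R) (p z : 'rV[R]_4).

Lemma S3S3P w : S3S3 R w <-> qdot w.1 w.1 = 1 /\ qdot w.2 w.2 = 1.
Proof. by rewrite /S3S3 /= !qabs1P. Qed.

(** The two components of a null vector have equal norms, so the first one alone detects zero. *)
Lemma coneP x : cone R x <->
  [/\ x.1 0 0 = 0, qdot x.1 x.1 = qdot x.2 x.2 & x.1 != 0].
Proof.
rewrite /cone /R7 /= Qpol1 /Q !qabs2E; split=> -[x0 /eqP].
  rewrite subr_eq0 => /eqP e xn0; split=> //; apply: contra_not_neq xn0 => x1.
  have : qdot x.2 x.2 == 0 by rewrite -e x1 qdot_eq0.
  by rewrite qdot_eq0 => /eqP x2; rewrite [x]surjective_pairing x1 x2.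
move=> /eqP e xn0; split=> //; first by rewrite e subrr.
by move=> x00; move: xn0; rewrite x00 eqxx.
Qed.

Lemma cone_gt0 x : cone R x -> 0 < qdot x.1 x.1.
Proof. by move=> /coneP[_ _ x1]; rewrite lt_neqAle eq_sym qdot_eq0 x1 qdot_ge0. Qed.

Lemma coneZ r x : r != 0 -> cone R x -> cone R (r *: x).
Proof.
move=> r0 /coneP[x0 e xn0]; apply/coneP; split; first by rewrite mxE x0 mulr0.
- by rewrite !qdotZ e.
- by rewrite scaler_eq0 negb_or r0.
Qed.

Definition Psi w : HH R :=
  (qmul (qmul (qconj w.1) qi) w.1, qmul (qconj w.1) w.2).

Definition dPsi w u : HH R :=
  (qmul (qmul (qconj u.1) qi) w.1 + qmul (qmul (qconj w.1) qi) u.1,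
   qmul (qconj u.1) w.2 + qmul (qconj w.1) u.2).

Lemma PhiE w : S3S3 R w -> Phi w = Psi w.
Proof. by move=> [w1 _]; rewrite /Phi /qinv w1 expr1n invr1 scale1r. Qed.

Lemma val_PhiK (w : S3S3 R) : \val (PhiK w) = Psi (\val w).
Proof. by rewrite /= PhiE//; exact: set_valP. Qed.

Lemma Psi_unit w : S3S3 R w ->
  qdot (Psi w).1 (Psi w).1 = 1 /\ qdot (Psi w).2 (Psi w).2 = 1.
Proof. by move=> /S3S3P[w1 w2]; rewrite /= !qdotM qdot_conj qdot_i w1 w2 !mulr1. Qed.

Lemma cone_Psi w : S3S3 R w -> cone R (Psi w).
Proof.
move=> Sw; have [w1 _] := (S3S3P _).1 Sw; have [n1 n2] := Psi_unit Sw.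
apply/coneP; split; first by rewrite re_conjugateV w1 /qi quatE mulr0.
- by rewrite n1 n2.
- by rewrite -qdot_eq0 n1 oner_eq0.
Qed.

(** In both components [qexpi t] meets its conjugate, directly or after crossing i, with which it
    commutes. *)
Lemma Psi_circle t w : Psi (circle_act t w) = Psi w.
Proof.
have e : qmul (qconj (qexpi t)) (qexpi t) = q1 :> 'rV[R]_4.
  rewrite qconj_mul /qexpi /qdot !quatE -!expr2 cos2Dsin2 !expr0n /= !addr0.
  by rewrite scale1r.
have ei : qmul qi (qexpi t) = qmul (qexpi t) qi :> 'rV[R]_4.
  by apply: quat_eq; rewrite /qmul /qexpi /qi !quatE; ring.
rewrite /Psi /circle_act /= !qconjM.
by congr pair; rewrite !qmulA -?(qmulA _ qi) ?ei -?(qmulA _ (qconj _)) ?e ?qmulr1//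
  !qmulA -(qmulA _ (qconj _)) e qmulr1.
Qed.

(** Both values of [Psi] have unit components, so r = 1. Equality of the first components says that
    u = w1' conj w1 commutes with i, hence is a unit complex number; equality of the second ones
    then gives w2' = u w2. *)
Lemma Psi_fiber w w' r : S3S3 R w -> S3S3 R w' -> 0 < r ->
  Psi w' = r *: Psi w -> exists t, w' = circle_act t w.
Proof.
move=> Sw Sw' r0; have [w1 w2] := (S3S3P _).1 Sw; have [w1' w2'] := (S3S3P _).1 Sw'.
move=> e; have [_] := Psi_unit Sw'; rewrite e qdotZ (Psi_unit Sw).2 mulr1 => /eqP.
rewrite -expr2 sqrf_eq1 => /orP[|/eqP r1]; last by move: r0; rewrite r1 oppr_gt0 ltr10.
move=> /eqP r1; move: e; rewrite r1 scale1r /Psi => -[e1 e2].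
pose u := qmul w'.1 (qconj w.1).
have uu : qdot u u = 1 by rewrite qdotM qdot_conj w1 w1' mulr1.
have [t ut] : exists t, u = qexpi t.
  have [u2 u3] : u 0 2 = 0 /\ u 0 3 = 0; last exact: unit_qexpi.
  apply: comm_qi; rewrite /u.
  have := congr1 (fun z => qmul (qmul w'.1 z) (qconj w.1)) e1.
  by rewrite !qmulA unit_qmul_conj// qmul1 !unit_qmulK// -!qmulA.
exists t; rewrite /circle_act -ut /u [w']surjective_pairing /=.
by rewrite unit_qmulVK// -qmulA -e2 unit_qVKmul.
Qed.

(** With v = x1 / |x1| this is the h = g - i g v of [conjugate_qi_section], whose normalization k
    satisfies conj k i k = v. It vanishes for some v; g remains a parameter because the Hopf map k
    |-> conj k i k has no global section. *)
Definition section_numerator (g : 'rV[R]_4) x : 'rV[R]_4 :=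
  g - qmul (qmul qi g) ((qabs x.1)^-1 *: x.1).

Definition Psi_section (g : 'rV[R]_4) x : HH R :=
  let k := (qabs (section_numerator g x))^-1 *: section_numerator g x in
  (k, qmul k ((qabs x.1)^-1 *: x.2)).

Lemma qabs_cone_gt0 x : cone R x -> 0 < qabs x.1.
Proof. by move=> cx; rewrite sqrtr_gt0 -qabs2 qabs2E cone_gt0. Qed.

Lemma Psi_sectionP g x : cone R x -> section_numerator g x != 0 ->
  S3S3 R (Psi_section g x) /\ x = qabs x.1 *: Psi (Psi_section g x).
Proof.
move=> cx; have [x0 xx xn0] := (coneP _).1 cx.
rewrite /Psi_section /section_numerator; have r0 := qabs_cone_gt0 cx.
have := qabs2E x.1; set r := qabs x.1 in r0 * => r2; set v := r^-1 *: x.1.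
have rn0 : r != 0 by rewrite gt_eqF.
have v0 : v 0 0 = 0 by rewrite mxE x0 mulr0.
have v1 : qdot v v = 1 by rewrite qdotZ -r2; field.
have /= := conjugate_qi_section g v0 v1; set k := _ - _ => ek kn0.
have := qabs2E k; set s := qabs k => s2.
have sn0 : s != 0 by rewrite -sqrf_eq0 s2 qdot_eq0.
have k1 : qdot (s^-1 *: k) (s^-1 *: k) = 1 by rewrite qdotZ -s2; field.
split; first by apply/S3S3P; rewrite qdotM k1 qdotZ -xx -r2 mul1r; split=> //; field.
rewrite /Psi /= unit_qKmul// [LHS]surjective_pairing; congr pair => /=; last first.
  by rewrite scalerA mulfV ?scale1r.
rewrite qconjZ !(qmulZl, qmulZr) ek -s2 !scalerA.
rewrite (_ : _ * r^-1 = 1) ?scale1r//; field.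
by rewrite rn0 sn0.
Qed.

Lemma Psi_surj x : cone R x ->
  exists w, S3S3 R w /\ exists2 r, 0 < r & x = r *: Psi w.
Proof.
(* Let b be the i-coordinate of v. For g = 1 the numerator has real part 1 + b, and for g = j it has
   j-coordinate 1 - b; these cannot both be zero. *)
move=> cx; have [g hg] : exists g, section_numerator g x != 0.
  have [h1|] := eqVneq (section_numerator q1 x) 0; last by exists q1.
  exists qj; apply/eqP; move: h1; rewrite /section_numerator; set v := _ *: x.1 => h1 hj.
  have := congr1 (fun q : 'rV[R]_4 => q 0 0) h1.
  have := congr1 (fun q : 'rV[R]_4 => q 0 2) hj.
  by clearbody v; rewrite /qmul /qi /qj /q1 !(quatE, mxE) ?quatE; lra.
have [Ss xE] := Psi_sectionP cx hg.
exists (Psi_section g x); split=> //; exists (qabs x.1) => //.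
exact: qabs_cone_gt0.
Qed.

(** For g = w1 one has i g v = i w1 (conj w1 i w1) = - w1, so the numerator is 2 w1 and the section
    passes through w itself. *)
Lemma Psi_section_Psi w r : S3S3 R w -> 0 < r ->
  section_numerator w.1 (r *: Psi w) != 0 /\ Psi_section w.1 (r *: Psi w) = w.
Proof.
move=> Sw r0; have [w1 w2] := (S3S3P _).1 Sw; have [n1 n2] := Psi_unit Sw.
have rE : qabs (r *: (Psi w).1) = r.
  apply/eqP; rewrite -(@eqrXn2 _ 2) ?(ltW r0) ?sqrtr_ge0//.
  by rewrite qabs2E qdotZ n1 mulr1 expr2.
have hE : section_numerator w.1 (r *: Psi w) = 2 *: w.1.
  rewrite /section_numerator /= rE scalerA mulVf ?gt_eqF// scale1r.
  rewrite !qmulA unit_qmulK// -(qmulA qi qi) qmul_ii opprK.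
  by rewrite scaler_nat mulr2n.
have nE : qabs (2 *: w.1) = 2.
  apply/eqP; rewrite -(@eqrXn2 _ 2) ?sqrtr_ge0//.
  by rewrite qabs2E qdotZ w1 mulr1 expr2.
rewrite /Psi_section hE nE /= rE !scalerA !mulVf ?gt_eqF//; split.
  by rewrite scaler_eq0 -qdot_eq0 w1 oner_eq0 orbF gt_eqF.
by rewrite !scale1r unit_qVKmul// -surjective_pairing.
Qed.

(** Conjugation negates the imaginary [p1], which produces the commutator in one component and the
    difference in the other. *)
Lemma dPsi_spin w p1 p2 : p1 0 0 = 0 ->
  dPsi w (qmul p1 w.1, qmul p2 w.2) =
  (qmul (qmul (qconj w.1) (qmul qi p1 - qmul p1 qi)) w.1,
   qmul (qmul (qconj w.1) (p2 - p1)) w.2).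
Proof.
move=> p10; rewrite /dPsi /= !qconjM (qconj_im p10).
by congr pair; rewrite !(qmulDl, qmulDr, qmulNl, qmulNr, qmulA) addrC.
Qed.

Lemma qmul_qi_qi : qmul qi qi = - q1 :> 'rV[R]_4.
Proof. by rewrite -[X in qmul _ X]qmulr1 qmul_ii. Qed.

(** On span(j, k) the commutator of i with p is 2 i p, so a has the preimage p = - i a / 2. *)
Lemma qi_commutator (a : 'rV[R]_4) : a 0 0 = 0 -> a 0 1 = 0 ->
  let p := quat 0 0 (a 0 3 / 2) (- a 0 2 / 2) in qmul qi p - qmul p qi = a.
Proof.
move=> a0 a1 p; apply: quat_eq;
  rewrite /p /qmul /qi !(quatE, mxE) ?quatE ?a0 ?a1; by field.
Qed.

(** Let al be the common value of the two scalar products. Once al [Psi w] is removed,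
    multiplication by w1, conj w1 and conj w2 moves the remainder to a pair (a, b), and the tangency
    conditions put a in span(j, k) and make b imaginary. It remains to solve [i, p1] = a and p2 - p1
    = b. *)
Lemma cone_tangent_decomposition w u : S3S3 R w ->
  u.1 0 0 = 0 -> qdot (Psi w).1 u.1 = qdot (Psi w).2 u.2 ->
  exists al p1 p2, [/\ p1 0 0 = 0, p2 0 0 = 0 &
    u = al *: Psi w + dPsi w (qmul p1 w.1, qmul p2 w.2)].
Proof.
move=> Sw u0 uT; have [w1 w2] := (S3S3P _).1 Sw; have [n1 n2] := Psi_unit Sw.
have qdotC a b : qdot a b = qdot b a by rewrite /qdot; ring.
have qdotBl a b c k : qdot (a - k *: b) c = qdot a c - k * qdot b c.
  by rewrite /qdot !mxE; ring.
pose al := qdot (Psi w).1 u.1.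
pose a := qmul (qmul w.1 (u.1 - al *: (Psi w).1)) (qconj w.1).
pose b := qmul (qmul w.1 (u.2 - al *: (Psi w).2)) (qconj w.2).
have a0 : a 0 0 = 0.
  have [psi0 _ _] := (coneP _).1 (cone_Psi Sw).
  have cB (c d : 'rV[R]_4) k : (c - k *: d) 0 0 = c 0 0 - k * d 0 0 by rewrite !mxE.
  by rewrite /a re_conjugate w1 cB u0 psi0 mulr0 subrr mulr0.
have a1 : a 0 1 = 0 by rewrite /a im_i_conjugate qdotBl n1 qdotC -/al mulr1 subrr.
have b0 : b 0 0 = 0 by rewrite /b re_qmulC qdotBl n2 qdotC -uT -/al mulr1 subrr.
pose p1 := quat 0 0 (a 0 3 / 2) (- a 0 2 / 2).
have ap1 := qi_commutator a0 a1; rewrite /= -/p1 in ap1.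
exists al, p1, (b + p1); split; first by rewrite quatE.
  by rewrite mxE b0 quatE addr0.
rewrite dPsi_spin ?quatE// ap1 addrK /a /b.
rewrite [LHS]surjective_pairing; congr pair => /=.
  by rewrite !qmulA unit_qconj_mul// qmul1 unit_qmulVK// addrC subrK.
by rewrite !qmulA unit_qconj_mul// qmul1 unit_qmulVK// addrC subrK.
Qed.

Lemma rolling_vecE rho a b w : let p := quat 0 0 a b in
  rolling_vec rho a b w = (qmul p w.1, qmul (rho *: p) w.2).
Proof.
rewrite /rolling_vec; congr pair; rewrite /= -!qmulZl -qmulDl; congr qmul.
all: by apply: quat_eq; rewrite /qj /qk !(quatE, mxE) ?quatE; ring.
Qed.

(** After cancellation of unit factors the product has components conj w1 (i i z + z) w1 and conj w1
    (- i z + i z) w2. The condition on z says that i z is imaginary, as membership in [R7]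
    requires. *)
Lemma zero_divisor_Psi w z : S3S3 R w -> z 0 1 = 0 ->
  Delta_at (Psi w) (qmul (qmul (qconj w.1) (qmul qi z)) w.1,
                    qmul (qmul (qconj w.1) z) w.2).
Proof.
move=> Sw z1; have [w1 w2] := (S3S3P _).1 Sw; split.
  rewrite /R7 /= Qpol1 /= re_conjugateV w1 /qmul /qi !quatE z1; ring.
rewrite /omul /= !qconjM qconjK qconj_i; congr pair.
  rewrite !qmulA unit_qmulK// unit_qmulK//.
  by rewrite -(qmulA _ qi qi) qmul_qi_qi !(qmulNl, qmulNr) qmulr1 addNr.
by rewrite !(qmulA, qmulNl, qmulNr) !unit_qmulK// addNr.
Qed.

(** The second component of y determines z, the second component of the product equation then yields
    the first component of y, and membership in [R7] kills the i-coordinate of z. *)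
Lemma zero_divisor_Psi_inv w y r : S3S3 R w -> 0 < r ->
  Delta_at (r *: Psi w) y -> exists z, z 0 1 = 0 /\
    y = (qmul (qmul (qconj w.1) (qmul qi z)) w.1,
         qmul (qmul (qconj w.1) z) w.2).
Proof.
move=> Sw r0; have [w1 w2] := (S3S3P _).1 Sw; rewrite /Delta_at /R7 /= Qpol1.
move=> [y0 e]; have /(congr1 snd)/= := e.
rewrite qconjZ qmulZl qmulZr -scalerDr => /eqP; rewrite scaler_eq0 gt_eqF//=.
rewrite !qconjM qconjK qconj_i !(qmulNl, qmulNr) addrC subr_eq0 => /eqP e2.
pose z := qmul (qmul w.1 y.2) (qconj w.2).
have y2 : y.2 = qmul (qmul (qconj w.1) z) w.2.
  by rewrite /z !qmulA unit_qmulVK// unit_qconj_mul// qmul1.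
have y1 : y.1 = qmul (qmul (qconj w.1) (qmul qi z)) w.1.
  have := congr1 (fun q => qmul (qmul q (qconj w.2)) w.1) e2.
  by rewrite /z !qmulA unit_qmulK// unit_qmulVK// => ->.
exists z; split; last by rewrite [LHS]surjective_pairing y1 y2.
have := y0; rewrite y1 re_conjugateV w1 mul1r /qmul /qi !quatE; lra.
Qed.

(** The ratio 3 enters here: 3 p - p equals the 2 p of [i, p] = 2 i p, so both components involve
    the same z = 2 p. *)
Lemma dPsi_rolling w p : p 0 0 = 0 -> p 0 1 = 0 ->
  dPsi w (qmul p w.1, qmul (3 *: p) w.2) =
  (qmul (qmul (qconj w.1) (qmul qi (2 *: p))) w.1,
   qmul (qmul (qconj w.1) (2 *: p)) w.2).
Proof.
move=> p0 p1; rewrite dPsi_spin//; congr (qmul (qmul _ _) _, qmul (qmul _ _) _).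
  by apply: quat_eq; rewrite /qmul /qi !(quatE, mxE) ?quatE ?p0 ?p1; ring.
by apply: quat_eq; rewrite !mxE; ring.
Qed.

Lemma zero_divisor_rolling w a b : S3S3 R w ->
  Delta_at (Psi w) (dPsi w (rolling_vec 3 a b w)).
Proof.
move=> Sw; rewrite rolling_vecE dPsi_rolling ?quatE//.
by apply: zero_divisor_Psi => //; rewrite mxE quatE mulr0.
Qed.

(** The shape of the sum is that of the velocity at 0 of a curve (r + al t) [Psi] (w(t)), as needed
    for [diff_at_ray]. *)
Lemma zero_divisor_rolling_inv w y r : S3S3 R w -> 0 < r ->
  Delta_at (r *: Psi w) y -> exists al a b,
    y = al *: Psi w + r *: dPsi w (rolling_vec 3 a b w).
Proof.
move=> Sw r0 /(zero_divisor_Psi_inv Sw r0)[z [z1 ->]].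
(* The real part of z is radial, since z = 1 yields [Psi w]. The rest of z must equal r (2 p) with p
   = a j + b k, whence the denominators 2 r. *)
exists (z 0 0), (z 0 2 / (2 * r)), (z 0 3 / (2 * r)).
rewrite rolling_vecE dPsi_rolling ?quatE//.
have rn0 : r != 0 by rewrite gt_eqF.
set p := quat _ _ _ _.
have zE : z = z 0 0 *: q1 + r *: (2 *: p).
  by apply: quat_eq; rewrite /p /q1 !(quatE, mxE) ?quatE ?z1; field.
rewrite [in LHS]zE; congr pair => /=.
  rewrite !(qmulDr, qmulDl) !(qmulZl, qmulZr); congr (_ *: _ + _).
  by rewrite !qmulA qmulr1.
by rewrite !(qmulDr, qmulDl) !(qmulZl, qmulZr) !qmulr1.
Qed.

End Rolling.

(** * Curves on the product of spheres and on the cone *)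

Section Curves.
Context {R : realType}.
Implicit Types (p q : 'rV[R]_4) (t : R).

Section SmoothQuaternion.
Context {V : normedModType R}.
Variable U : set V.
Hypothesis oU : open U.

Lemma smooth_row4 (f : V -> 'rV[R]_4) :
  smooth_on U (fun x => f x 0 0 : R^o) -> smooth_on U (fun x => f x 0 1 : R^o) ->
  smooth_on U (fun x => f x 0 2 : R^o) -> smooth_on U (fun x => f x 0 3 : R^o) ->
  smooth_on U f.
Proof.
move=> f0 f1 f2 f3; apply: smooth_row => // -[[|[|[|[|//]]]] p].
- by rewrite (_ : Ordinal p = 0)//; exact: val_inj.
- by rewrite (_ : Ordinal p = 1)//; exact: val_inj.
- by rewrite (_ : Ordinal p = 2)//; exact: val_inj.
- by rewrite (_ : Ordinal p = 3)//; exact: val_inj.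
Qed.

Lemma smooth_quat (a b c d : V -> R^o) :
  smooth_on U a -> smooth_on U b -> smooth_on U c -> smooth_on U d ->
  smooth_on U (fun x => quat (a x) (b x) (c x) (d x)).
Proof.
move=> sa sb sc sd; apply: smooth_row4.
- by under eq_fun do rewrite quatE.
- by under eq_fun do rewrite quatE.
- by under eq_fun do rewrite quatE.
- by under eq_fun do rewrite quatE.
Qed.

Lemma smooth_qmul (f g : V -> 'rV[R]_4) :
  smooth_on U f -> smooth_on U g -> smooth_on U (fun x => qmul (f x) (g x)).
Proof.
move=> sf sg.
have sfi i : smooth_on U (fun x => f x 0 i : R^o) by exact: smooth_coord.
have sgi i : smooth_on U (fun x => g x 0 i : R^o) by exact: smooth_coord.
by apply: smooth_quat;
  repeat first [apply: smoothB => // | apply: smoothD => // | apply: smoothM => //].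
Qed.

Lemma smooth_qconj (f : V -> 'rV[R]_4) :
  smooth_on U f -> smooth_on U (fun x => qconj (f x)).
Proof.
move=> sf.
have sfi i : smooth_on U (fun x => f x 0 i : R^o) by exact: smooth_coord.
by apply: smooth_quat => //; exact: smoothN.
Qed.

Lemma smooth_Psi (f : V -> HH R) :
  smooth_on U f -> smooth_on U (fun x => Psi (f x)).
Proof.
move=> sf.
have s1 : smooth_on U (fun x => (f x).1) by exact: smooth_fst.
have s2 : smooth_on U (fun x => (f x).2) by exact: smooth_snd.
apply: smooth_pair => //; apply: smooth_qmul => //; last exact: smooth_qconj.
by apply: smooth_qmul; [exact: smooth_qconj|exact: smooth_cst].
Qed.

End SmoothQuaternion.

Lemma smooth_id {V : normedModType R} (U : set V) : smooth_on U id.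
Proof. by apply: (smooth_linear U (f := idfun)) => x; exact: cvg_id. Qed.

(** [Psi] is homogeneous quadratic, so its expansion at w is exact, with second-order coefficient
    [Psi u]. *)
Lemma derive_Psi (w u : HH R) : 'D_u Psi w = dPsi w u.
Proof.
pose c : HH R := (qmul (qmul (qconj u.1) qi) u.1, qmul (qconj u.1) u.2).
apply: (@derive_expansion _ _ _ _ _ _ _ (fun=> c)); last exact: cvg_cst.
have expand (h : R) (k l m n : 'rV[R]_4) :
    h *: (h *: k + l) + (h *: m + n) = n + h *: (m + l) + h ^+ 2 *: k.
  by apply/rowP => i; rewrite !mxE; ring.
move=> h; rewrite /Psi /dPsi /c; congr pair => /=.
  by rewrite !(qconjD, qconjZ, qmulDl, qmulDr, qmulZl, qmulZr) expand.
by rewrite !(qconjD, qconjZ, qmulDl, qmulDr, qmulZl, qmulZr) expand.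
Qed.

(* The Cayley transform of t p / 2, a rational curve on the unit sphere. *)
Definition cayley (p : 'rV[R]_4) (t : R^o) : 'rV[R]_4 :=
  (1 + t ^+ 2 * (qdot p p / 4))^-1 *:
    ((1 - t ^+ 2 * (qdot p p / 4)) *: q1 + t *: p).

Lemma cayley_gt0 p (t : R) : 0 < 1 + t ^+ 2 * (qdot p p / 4).
Proof. by rewrite ltr_pwDl// mulr_ge0 ?sqr_ge0// divr_ge0 ?qdot_ge0. Qed.

(** With s = t^2 |p|^2 / 4 and p orthogonal to 1, the squared norm of the numerator is (1 - s)^2 + 4
    s = (1 + s)^2. *)
Lemma qdot_cayley p t : p 0 0 = 0 -> qdot (cayley p t) (cayley p t) = 1.
Proof.
move=> p0; have := cayley_gt0 p t; rewrite /cayley qdotZ.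
have -> a : qdot (a *: q1 + t *: p) (a *: q1 + t *: p) = a ^+ 2 + t ^+ 2 * qdot p p.
  by rewrite /qdot /q1 !mxE ?quatE p0 /=; ring.
set n := qdot p p => d0; have dn0 : 4 + t ^+ 2 * n != 0 by apply: lt0r_neq0; nra.
by field.
Qed.

Lemma cayley0 p : cayley p 0 = q1.
Proof. by rewrite /cayley expr0n /= mul0r scale0r addr0 subr0 addr0 invr1 !scale1r. Qed.

Lemma smooth_cayley p (U : set R^o) : open U -> smooth_on U (cayley p).
Proof.
move=> oU; have sid : smooth_on U (fun x : R^o => x) by exact: smooth_id.
have sc (a : R^o) : smooth_on U (fun=> a) by exact: smooth_cst.
have sq : smooth_on U (fun t : R^o => t ^+ 2 * (qdot p p / 4) : R^o).
  by apply: smoothM => //; exact: smoothX.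
apply: smoothZ => //.
  apply: smoothV => //; last exact: smoothD.
  by move=> t _; rewrite gt_eqF// cayley_gt0.
apply: smoothD => //; apply: smoothZ => //; try exact: smooth_cst.
exact: smoothB.
Qed.

Lemma derive_cayley p : 'D_1 (cayley p) (0 : R^o) = p.
Proof.
(* This is the exact remainder in [cayley p t] = 1 + t p + t^2 c(t). *)
pose c (t : R) : 'rV[R]_4 := (1 + t ^+ 2 * (qdot p p / 4))^-1 *:
  (- (qdot p p / 2) *: q1 - (t * (qdot p p / 4)) *: p).
apply: (@derive_expansion _ _ _ _ _ _ _ c).
  move=> h; rewrite cayley0 /cayley /c addr0 (_ : h *: 1 = h); last exact: mulr1.
  have := cayley_gt0 p h; set n := qdot p p / 4.
  have -> : qdot p p / 2 = 2 * n by rewrite /n; field.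
  set d := 1 + _ => d0; have dn0 : d != 0 by rewrite gt_eqF.
  by apply/rowP => i; rewrite !mxE; rewrite /d in dn0 *; field.
have oT : open [set: R^o] by exact: openT.
have sid : smooth_on setT (fun x : R^o => x) by exact: smooth_id.
have sc (a : R^o) : smooth_on setT (fun=> a : R^o) by exact: smooth_cst.
apply: (smooth_continuous (U := setT)) => //.
apply: smoothZ => //.
  apply: smoothV => //; last first.
    by apply: smoothD => //; apply: smoothM => //; exact: smoothX.
  by move=> t _; rewrite gt_eqF// cayley_gt0.
apply: smoothD; [by []|exact: smooth_cst|].
under eq_fun do rewrite -scaleNr -mulNr.
apply: smoothZ => //; last exact: smooth_cst.
by apply: smoothM => //; exact: smoothN.
Qed.

Definition rotation (w : HH R) p1 p2 (t : R^o) : HH R :=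
  (qmul (cayley p1 t) w.1, qmul (cayley p2 t) w.2).

Lemma rotation0 w p1 p2 : rotation w p1 p2 0 = w.
Proof. by rewrite /rotation !cayley0 !qmul1 -surjective_pairing. Qed.

Lemma S3S3_rotation w p1 p2 t : S3S3 R w -> p1 0 0 = 0 -> p2 0 0 = 0 ->
  S3S3 R (rotation w p1 p2 t).
Proof.
move=> /S3S3P[w1 w2] p10 p20; apply/S3S3P => /=.
by rewrite !qdotM !qdot_cayley// w1 w2 mulr1.
Qed.

Lemma smooth_rotation w p1 p2 (U : set R^o) : open U -> smooth_on U (rotation w p1 p2).
Proof.
move=> oU; apply: smooth_pair => //; apply: smooth_qmul => //;
  by [exact: smooth_cayley|exact: smooth_cst].
Qed.

Lemma derive_qmulr {V : normedModType R} (f : V -> 'rV[R]_4) q x v :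
  differentiable f x -> 'D_v (fun y => qmul (f y) q) x = qmul ('D_v f x) q.
Proof.
move=> df.
have lq : linear (fun y : 'rV[R]_4 => qmul y q : 'rV[R]_4).
  by move=> a y z; rewrite qmulDl qmulZl.
pose L0 := GRing.isLinear.Build _ _ _ _ _ lq.
pose L : {linear 'rV[R]_4 -> 'rV[R]_4} := HB.pack (fun y => qmul y q) L0.
have cL : continuous L.
  move=> y; apply: (smooth_continuous (U := setT)) => //.
  apply: (smooth_qmul openT); [exact: smooth_id|exact: smooth_cst].
have dL y : differentiable L y by exact: linear_differentiable.
by rewrite (derive_comp (g := L) v df (dL _)) deriveE// (diff_lin _ cL).
Qed.

Lemma derive_rotation w p1 p2 :
  'D_1 (rotation w p1 p2) (0 : R^o) = (qmul p1 w.1, qmul p2 w.2).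
Proof.
have dc p : differentiable (cayley p) (0 : R^o).
  by apply: (smooth_cayley p openT 1%N).1.
have dq p q : differentiable (fun t => qmul (cayley p t) q) (0 : R^o).
  have := smooth_qmul openT (smooth_cayley p openT) (smooth_cst setT q).
  by move=> /(_ 1%N)[+ _]; exact.
by rewrite derive_pair// !derive_qmulr// !derive_cayley.
Qed.

Lemma rotation_curve (w : S3S3 R) p1 p2 e : 0 < e -> p1 0 0 = 0 -> p2 0 0 = 0 ->
  curve_on w e (rotation (\val w) p1 p2) (qmul p1 (\val w).1, qmul p2 (\val w).2).
Proof.
move=> e0 p10 p20; split=> //.
- exact/smooth_rotation/open_norm_lt.
- by move=> t _; apply: S3S3_rotation => //; exact: set_valP.
- exact: rotation0.
- exact: derive_rotation.
Qed.

(* Both sides are the derivative at 0 of f along the rays through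
   Psi (rotation w p1 p2 t). *)
Lemma diff_at_ray (W : normedModType R) (f : K R -> W) (w : S3S3 R) (x : cone R)
    r al p1 p2 : 0 < r -> \val x = r *: Psi (\val w) -> p1 0 0 = 0 -> p2 0 0 = 0 ->
  smooth_at (f \o \pi_(K R)) x -> smooth_at (f \o \pi_(K R) \o @PhiK R) w ->
  let u := (qmul p1 (\val w).1, qmul p2 (\val w).2) : HH R in
  tangent_at x (al *: Psi (\val w) + r *: dPsi (\val w) u) /\
  diff_at (f \o \pi_(K R)) x (al *: Psi (\val w) + r *: dPsi (\val w) u) =
  diff_at (f \o \pi_(K R) \o @PhiK R) w u.
Proof.
move=> r0 xE p10 p20 sf sfP u.
(* For |t| < e the factor r + t al stays positive, so the curve below remains on the rays of [Psi];
   the added 1 allows al = 0. *)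
pose e := r / (`|al| + 1).
have e0 : 0 < e by rewrite divr_gt0// ltr_pwDr.
have pos t : `|t| < e -> 0 < r + t * al.
  have a1 : 0 < `|al| + 1 by rewrite ltr_pwDr.
  rewrite ltr_pdivlMr// => te.
  have : `|t * al| < r.
    by rewrite normrM; apply: le_lt_trans te; rewrite ler_wpM2l// lerDl.
  by rewrite ltr_norml => /andP[]; lra.
pose c (t : R^o) : HH R := (r + t * al) *: Psi (rotation (\val w) p1 p2 t).
have oe : open [set t : R^o | `|t| < e] by exact: open_norm_lt.
have Sw : S3S3 R (\val w) by exact: set_valP.
have Srot t : S3S3 R (rotation (\val w) p1 p2 t) by exact: S3S3_rotation.
have cc : curve_on x e c (al *: Psi (\val w) + r *: dPsi (\val w) u).
  have sm (U : set R^o) : open U -> smooth_on U (fun t : R^o => r + t * al : R^o).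
    move=> oU; apply: smoothD => //; first exact: smooth_cst.
    by apply: smoothM => //; [exact: smooth_id|exact: smooth_cst].
  have sr (U : set R^o) : open U ->
      smooth_on U (fun t : R^o => Psi (rotation (\val w) p1 p2 t)).
    by move=> oU; apply: smooth_Psi => //; exact: smooth_rotation.
  split=> //.
  - by apply: smoothZ => //; [exact: sm|exact: sr].
  - by move=> t te; apply: coneZ; [rewrite gt_eqF// pos|exact: cone_Psi].
  - by rewrite /c mul0r addr0 rotation0 xE.
  - have d1 : differentiable (fun t : R^o => r + t * al : R^o) 0.
      by apply: (sm setT openT 1%N).1.
    have d2 : differentiable (fun t : R^o => Psi (rotation (\val w) p1 p2 t)) 0.
      by apply: (sr setT openT 1%N).1.
    have [d3 eq3] := diff_scaler d1 d2.
    rewrite /c deriveE// eq3 -!deriveE// mul0r addr0 rotation0 addrC; congr (_ *: _ + _ *: _).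
      have -> : 'D_1 (fun t : R^o => r + t * al : R^o) 0 = al.
        apply: (@derive_expansion _ _ _ _ _ _ _ (fun=> 0)); last exact: cvg_cst.
        by move=> h; rewrite /GRing.scale /=; ring.
      by [].
    have dr : differentiable (rotation (\val w) p1 p2) 0.
      by apply: (smooth_rotation (\val w) p1 p2 openT 1%N).1.
    have dP y : differentiable (@Psi R) y.
      by apply: (smooth_Psi openT (smooth_id _) 1%N).1.
    by rewrite (derive_comp (g := @Psi R) (1 : R^o) dr (dP _)) derive_rotation rotation0 derive_Psi.
split; first by exists e, c.
(* As the factor r + t al is positive, [c t] and [Psi] of the rotated point span the same ray: h is
   f read along both curves. *)
pose h (t : R^o) := f (\pi_(K R) (PhiK (SigSub (mem_set (Srot t))))).
rewrite (diff_at_curve (h := h) sf cc).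
  apply/esym/(diff_at_curve (e := e) (c := rotation (\val w) p1 p2)) => //.
    exact: rotation_curve.
  move=> t y te yE; rewrite /h /=; do 3 congr (_ _).
  by apply: val_inj => /=; rewrite yE.
move=> t y te yE; rewrite /h /=; congr (f _); apply/eqmodP/asboolP.
exists (r + t * al); split; first exact: pos.
by rewrite yE val_PhiK.
Qed.

Lemma derive_tangent_eq0 (E : normedModType R) (A : set E) (x : A) u (F : E -> R^o) :
  tangent_at x u -> smooth_on setT F -> (forall y, A y -> F y = 0) ->
  'D_u F (\val x) = 0.
Proof.
move=> [e [c [e0 sc Ac c0 cu]]] sF F0.
have dF : differentiable F (c 0) by apply: (sF 1%N).1.
have dc : differentiable c 0 by apply: (sc 1%N).1; rewrite /= normr0.
rewrite -c0 -cu -derive_comp// -[RHS](derive_cst (0 : R^o) (0 : R^o) (1 : R^o)).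
apply: near_eq_derive.
by apply: filterS (near_norm_lt e0) => t te /=; rewrite F0//; exact: Ac.
Qed.

(** Tangent vectors annihilate the differentials of the two functions that cut out the cone, Re x1
    and |x1|^2 - |x2|^2. The resulting equations feed [cone_tangent_decomposition]. *)
Lemma tangent_cone (x : cone R) u : tangent_at x u ->
  u.1 0 0 = 0 /\ qdot (\val x).1 u.1 = qdot (\val x).2 u.2.
Proof.
move=> tu.
have s1 i : smooth_on [set: HH R] (fun y => y.1 0 i : R^o).
  by apply: smooth_coord; [exact: openT|apply: smooth_fst; [exact: openT|exact: smooth_id]].
have s2 i : smooth_on [set: HH R] (fun y => y.2 0 i : R^o).
  by apply: smooth_coord; [exact: openT|apply: smooth_snd; [exact: openT|exact: smooth_id]].
split.
  have <- : 'D_u (fun y : HH R => y.1 0 0 : R^o) (\val x) = u.1 0 0.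
    apply: (@derive_expansion _ _ _ _ _ _ _ (fun=> 0)); last exact: cvg_cst.
    by move=> h; rewrite /= !mxE /GRing.scale /=; ring.
  by apply: derive_tangent_eq0 => // y /coneP[].
have : 'D_u (fun y : HH R => qdot y.1 y.1 - qdot y.2 y.2 : R^o) (\val x) =
    2 * (qdot (\val x).1 u.1 - qdot (\val x).2 u.2).
  apply: (@derive_expansion _ _ _ _ _ _ _ (fun=> qdot u.1 u.1 - qdot u.2 u.2));
    last exact: cvg_cst.
  by move=> h; rewrite /qdot /= !mxE /GRing.scale /=; ring.
rewrite derive_tangent_eq0//.
- by move=> /eqP; rewrite eq_sym mulf_eq0 pnatr_eq0/= subr_eq0 => /eqP.
- by rewrite /qdot; apply: smoothB; [exact: openT| |];
    repeat first [apply: smoothD => // | apply: smoothM => // | exact: openT].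
- by move=> y /coneP[_ -> _]; rewrite subrr.
Qed.

End Curves.

(** * Charts of K *)

Section ConeCharts.
Context {R : realType}.
Implicit Types (w x : HH R) (y : 'rV[R]_5).

(** For w in S^3 x S^3 this linear map preserves the cone and sends [Psi w] to (i, 1), so that one
    fixed chart around (i, 1) can be transported to any ray. *)
Definition turn w x : HH R :=
  (qmul (qmul w.1 x.1) (qconj w.1), qmul (qmul w.1 x.2) (qconj w.2)).

Definition unturn w x : HH R :=
  (qmul (qmul (qconj w.1) x.1) w.1, qmul (qmul (qconj w.1) x.2) w.2).

Lemma turnK w x : S3S3 R w -> unturn w (turn w x) = x.
Proof.
move=> /S3S3P[w1 w2]; rewrite /unturn /turn /= !qmulA !unit_qconj_mul// !qmul1.
by rewrite !unit_qmulVK// -surjective_pairing.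
Qed.

Lemma unturnK w x : S3S3 R w -> turn w (unturn w x) = x.
Proof.
move=> /S3S3P[w1 w2]; rewrite /unturn /turn /= !qmulA !unit_qmul_conj// !qmul1.
by rewrite !unit_qmulK// -surjective_pairing.
Qed.

Lemma turnZ w r x : turn w (r *: x) = r *: turn w x.
Proof. by rewrite /turn /= !qmulZr !qmulZl. Qed.

Lemma unturnZ w r x : unturn w (r *: x) = r *: unturn w x.
Proof. by rewrite /unturn /= !qmulZr !qmulZl. Qed.

Lemma cone_unturn w x : S3S3 R w -> cone R x -> cone R (unturn w x).
Proof.
move=> /S3S3P[w1 w2] /coneP[x0 e xn0]; apply/coneP; split => /=.
- by rewrite re_conjugateV x0 mulr0.
- by rewrite !qdotM !qdot_conj w1 w2 e.
- by rewrite -qdot_eq0 !qdotM qdot_conj w1 mul1r mulr1 qdot_eq0.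
Qed.

Lemma cone_turn w x : S3S3 R w -> cone R x -> cone R (turn w x).
Proof.
move=> /S3S3P[w1 w2] /coneP[x0 e xn0]; apply/coneP; split => /=.
- by rewrite re_conjugate x0 mulr0.
- by rewrite !qdotM !qdot_conj w1 w2 e.
- by rewrite -qdot_eq0 !qdotM qdot_conj w1 mul1r mulr1 qdot_eq0.
Qed.

Definition row5 (a b c d e : R) : 'rV[R]_5 := \row_l [:: a; b; c; d; e]`_l.

Lemma row5_eta y : y = row5 (y 0 0) (y 0 1) (y 0 2) (y 0 3) (y 0 4).
Proof.
by apply/rowP => -[[|[|[|[|[|//]]]]] p]; rewrite mxE /=; congr (y _ _); exact: val_inj.
Qed.

(* Light-cone stereographic coordinates: (i, 1) and (i, -1) are isotropic, and a
   point of the cone is determined by its orthogonal projection on the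
   complement of their span, once normalized by height 1. *)
Definition flat_height x : R := x.1 0 1 + x.2 0 0.

Definition flat_coord x : 'rV[R]_5 :=
  (flat_height x)^-1 *: row5 (x.1 0 2) (x.1 0 3) (x.2 0 1) (x.2 0 2) (x.2 0 3).

Lemma flat_heightZ r x : flat_height (r *: x) = r * flat_height x.
Proof. by rewrite /flat_height !mxE mulrDr. Qed.

Lemma flat_coordZ r x : r != 0 -> flat_coord (r *: x) = flat_coord x.
Proof.
move=> r0; rewrite /flat_coord flat_heightZ /= !mxE.
rewrite (_ : row5 _ _ _ _ _ = r *: row5 (x.1 0 2) (x.1 0 3) (x.2 0 1) (x.2 0 2)
  (x.2 0 3)); first by rewrite scalerA invfM mulrAC mulVf// mul1r.
by rewrite [RHS]row5_eta !mxE.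
Qed.

(** On the slice of height 1 the two missing coordinates have sum 1, and the null equation makes
    their difference d. *)
Definition paraboloid y : HH R :=
  let d := y 0 2 ^+ 2 + y 0 3 ^+ 2 + y 0 4 ^+ 2 - y 0 0 ^+ 2 - y 0 1 ^+ 2 in
  (quat 0 ((1 + d) / 2) (y 0 0) (y 0 1),
   quat ((1 - d) / 2) (y 0 2) (y 0 3) (y 0 4)).

Lemma flat_height_paraboloid y : flat_height (paraboloid y) = 1.
Proof. by rewrite /flat_height /paraboloid /= !quatE; field. Qed.

Lemma flat_coordK y : flat_coord (paraboloid y) = y.
Proof.
rewrite /flat_coord flat_height_paraboloid invr1 scale1r /paraboloid /= !quatE.
by rewrite -row5_eta.
Qed.

Lemma cone_paraboloid y : cone R (paraboloid y).
Proof.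
apply/coneP; split; rewrite ?quatE//.
  by rewrite /qdot /paraboloid /= !quatE; field.
apply/eqP => p0; have := flat_height_paraboloid y; rewrite /flat_height p0 mxE add0r.
have : qdot (paraboloid y).2 (paraboloid y).2 = 0.
  have <- : qdot (paraboloid y).1 (paraboloid y).1 = 0.
    by apply/eqP; rewrite qdot_eq0 p0.
  by rewrite /qdot /paraboloid /= !quatE; field.
by move=> /eqP; rewrite qdot_eq0 => /eqP ->; rewrite mxE => /eqP; rewrite eq_sym oner_eq0.
Qed.

(** The null equation, written as a difference of squares, gives d = (x1_i - x2_0) / h after
    normalization by the height h = x1_i + x2_0; then (1 + d) / 2 and (1 - d) / 2 are x1_i / h and
    x2_0 / h. *)
Lemma paraboloidK x : cone R x -> 0 < flat_height x ->
  paraboloid (flat_coord x) = (flat_height x)^-1 *: x.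
Proof.
move=> /coneP[x0 e _]; rewrite /flat_coord /flat_height => h0.
have hn0 : x.1 0 1 + x.2 0 0 != 0 by rewrite gt_eqF.
move: e; rewrite /qdot x0.
case: x x0 h0 hn0 => u v /= u0 h0 hn0 e.
have d2 : v 0 1 ^+ 2 + v 0 2 ^+ 2 + v 0 3 ^+ 2 - u 0 2 ^+ 2 - u 0 3 ^+ 2
   = (u 0 1 - v 0 0) * (u 0 1 + v 0 0).
  apply/eqP; rewrite -subr_eq0; apply/eqP; move/esym/eqP: e.
  by rewrite -subr_eq0 => /eqP <-; ring.
rewrite /paraboloid !mxE /=; set h := u 0 1 + v 0 0 in h0 hn0 d2 *.
have dE : (h^-1 * v 0 1) ^+ 2 + (h^-1 * v 0 2) ^+ 2 + (h^-1 * v 0 3) ^+ 2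
  - (h^-1 * u 0 2) ^+ 2 - (h^-1 * u 0 3) ^+ 2 = (u 0 1 - v 0 0) / h.
  by rewrite !exprMn -!mulrDr -!mulrBr d2; field.
rewrite dE; congr pair; apply: quat_eq; rewrite !(quatE, mxE) ?u0 ?mulr0//.
  by rewrite /h in hn0 *; field.
by rewrite /h in hn0 *; field.
Qed.

Lemma smooth_row5 {V : normedModType R} (U : set V) (a b c d e : V -> R^o) :
  open U -> smooth_on U a -> smooth_on U b -> smooth_on U c -> smooth_on U d ->
  smooth_on U e -> smooth_on U (fun z => row5 (a z) (b z) (c z) (d z) (e z)).
Proof.
move=> oU sa sb sc sd se; apply: smooth_row => // -[[|[|[|[|[|//]]]]] p];
  by under eq_fun do rewrite mxE /=.
Qed.

Section Turned.
Variable w : HH R.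
Hypothesis Sw : S3S3 R w.

Definition height x : R := flat_height (turn w x).
Definition coordK x : 'rV[R]_5 := flat_coord (turn w x).
Definition paramK y : HH R := unturn w (paraboloid y).

Lemma heightZ r x : height (r *: x) = r * height x.
Proof. by rewrite /height turnZ flat_heightZ. Qed.

Lemma coordKZ r x : r != 0 -> coordK (r *: x) = coordK x.
Proof. by move=> r0; rewrite /coordK turnZ flat_coordZ. Qed.

Lemma cone_paramK y : cone R (paramK y).
Proof. exact/cone_unturn/cone_paraboloid. Qed.

Lemma height_paramK y : height (paramK y) = 1.
Proof. by rewrite /height /paramK unturnK// flat_height_paraboloid. Qed.

Lemma paramKK y : coordK (paramK y) = y.
Proof. by rewrite /coordK /paramK unturnK// flat_coordK. Qed.

Lemma coordKK x : cone R x -> 0 < height x ->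
  paramK (coordK x) = (height x)^-1 *: x.
Proof.
move=> cx h0; rewrite /paramK /coordK paraboloidK//; last exact: cone_turn.
by rewrite unturnZ turnK.
Qed.

(** [turn w] moves [Psi w] to (i, 1), of height 1 + 1. Positivity of this value makes the charts
    cover K. *)
Lemma height_Psi : height (Psi w) = 2.
Proof.
rewrite (_ : Psi w = unturn w (qi, q1)).
  by rewrite /height unturnK// /flat_height /qi /q1 !quatE; ring.
by rewrite /Psi /unturn /= qmulr1.
Qed.

Lemma smooth_turn : smooth_on setT (turn w).
Proof.
have s1 : smooth_on setT (fun x : HH R => x.1).
  by apply: smooth_fst; [exact: openT|exact: smooth_id].
have s2 : smooth_on setT (fun x : HH R => x.2).
  by apply: smooth_snd; [exact: openT|exact: smooth_id].
apply: smooth_pair; first exact: openT.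
  by apply: smooth_qmul; [exact: openT| |exact: smooth_cst];
    apply: smooth_qmul => //; [exact: openT|exact: smooth_cst].
by apply: smooth_qmul; [exact: openT| |exact: smooth_cst];
  apply: smooth_qmul => //; [exact: openT|exact: smooth_cst].
Qed.

Let oT : open [set: HH R]. Proof. exact: openT. Qed.

Lemma smooth_turn1 i : smooth_on setT (fun x => (turn w x).1 0 i : R^o).
Proof. by apply: smooth_coord => //; apply: smooth_fst => //; exact: smooth_turn. Qed.

Lemma smooth_turn2 i : smooth_on setT (fun x => (turn w x).2 0 i : R^o).
Proof. by apply: smooth_coord => //; apply: smooth_snd => //; exact: smooth_turn. Qed.

Lemma smooth_height : smooth_on setT (height : HH R -> R^o).
Proof. by apply: smoothD => //; [exact: smooth_turn1|exact: smooth_turn2]. Qed.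

Lemma open_height : open [set x | 0 < height x].
Proof.
have -> : [set x | 0 < height x] = (height : HH R -> R^o) @^-1` [set s | 0 < s] by [].
apply: open_comp => [x _|]; last exact: open_gt.
exact: smooth_continuous smooth_height I.
Qed.

Lemma smooth_coordK : smooth_on [set x | 0 < height x] coordK.
Proof.
have oh := open_height.
apply: smoothZ => //.
  apply: smoothV => //; first by move=> x h0; rewrite gt_eqF.
  exact: smooth_sub smooth_height.
by apply: smooth_row5 => //; first [apply: smooth_sub (smooth_turn1 _)|
  apply: smooth_sub (smooth_turn2 _)].
Qed.

Lemma smooth_paramK {V : normedModType R} (U : set V) (f : V -> 'rV[R]_5) :
  open U -> smooth_on U f -> smooth_on U (fun z => paramK (f z)).
Proof.
move=> oU sf.
have sfi i : smooth_on U (fun z => f z 0 i : R^o) by exact: smooth_coord.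
have sfi2 i : smooth_on U (fun z => f z 0 i ^+ 2 : R^o) by exact: smoothX.
have sc (W : normedModType R) (a : W) : smooth_on U (fun=> a) by exact: smooth_cst.
apply: smooth_pair => //; apply: smooth_qmul => //; apply: smooth_qmul => //;
  apply: smooth_quat => //; apply: smoothM => //.
all: by repeat first [apply: smoothB => // | apply: smoothD => //].
Qed.

End Turned.

End ConeCharts.

(** * The atlas of the space of rays *)

Section ChartsOfK.
Context {R : realType}.
Implicit Types (w : S3S3 R) (y : 'rV[R]_5).

Lemma pi_KP (x x' : cone R) : \pi_(K R) x = \pi_(K R) x' <->
  exists2 r, 0 < r & \val x' = r *: \val x.
Proof.
have eP := @eqmodP _ (ray_equiv R) x x'; split=> [e|[r r0 e]].
  have /asboolP[r [r0 ?]] : ray_rel x x' by exact: (introT eP e).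
  by exists r.
by apply: (elimT eP); apply/asboolP; exists r.
Qed.

Lemma pi_MP (w w' : S3S3 R) : \pi_(M R) w = \pi_(M R) w' <->
  exists t, \val w' = circle_act t (\val w).
Proof.
have eP := @eqmodP _ (circle_equiv R) w w'; split=> [e|e].
  by have /asboolP : circle_rel w w' by exact: (introT eP e).
by apply: (elimT eP); apply/asboolP.
Qed.

Lemma repr_pi_K (x : cone R) : exists2 r, 0 < r &
  \val (repr (\pi_(K R) x)) = r *: \val x.
Proof. by apply/pi_KP; rewrite reprK. Qed.

(** Height and coordinates are read on the canonical representative; positive scaling preserves the
    coordinates and the sign of the height. Requiring a positive height, not just a nonzero one,
    separates a ray from its opposite, which has the same coordinates. *)
Definition chartK (w : S3S3 R) : chart (K R) 5 := Chart
  [set p | 0 < height (\val w) (\val (repr p))]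
  (fun p => coordK (\val w) (\val (repr p)))
  (fun y => \pi_(K R) (SigSub (mem_set (cone_paramK (set_valP w) y)))).

Lemma cdom_chartK w (x : cone R) :
  cdom (chartK w) (\pi_(K R) x) <-> 0 < height (\val w) (\val x).
Proof.
by have [r r0 e] := repr_pi_K x; rewrite /= e heightZ pmulr_rgt0.
Qed.

Lemma cmap_chartK w (x : cone R) :
  cmap (chartK w) (\pi_(K R) x) = coordK (\val w) (\val x).
Proof. by have [r r0 e] := repr_pi_K x; rewrite /= e coordKZ ?gt_eqF. Qed.

Lemma open_set_type (T : topologicalType) (A : set T) (O : set A) :
  open O <-> exists2 B, open B & O = \val @^-1` B.
Proof. by split=> [[B oB <-]|[B oB ->]]; exists B. Qed.

Lemma open_quotient (T : topologicalType) (Q0 : quotType T)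
    (O : set (quotient_topology Q0)) :
  open O <-> open (\pi_(quotient_topology Q0) @^-1` O).
Proof. by []. Qed.

Lemma cmap_cinv_chartK w y : cmap (chartK w) (cinv (chartK w) y) = y.
Proof. by rewrite [cinv _ _]/= cmap_chartK /= paramKK//; exact: set_valP. Qed.

Lemma cdom_cinv_chartK w y : cdom (chartK w) (cinv (chartK w) y).
Proof.
by rewrite [cinv _ _]/=; apply/cdom_chartK; rewrite /= height_paramK//; exact: set_valP.
Qed.

Lemma cimg_chartK w : cimg (chartK w) = setT.
Proof.
apply/seteqP; split=> // y _; exists (cinv (chartK w) y); last exact: cmap_cinv_chartK.
exact: cdom_cinv_chartK.
Qed.

Lemma open_cdom_chartK w : open (cdom (chartK w)).
Proof.
apply/open_quotient/open_set_type; exists [set x | 0 < height (\val w) x].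
  exact: open_height.
by apply/seteqP; split=> x; [exact: (cdom_chartK w x).1|exact: (cdom_chartK w x).2].
Qed.

Lemma continuous_within_open (T T' : topologicalType) (D : set T) (f : T -> T') :
  open D -> (forall O, open O -> open (D `&` f @^-1` O)) ->
  {within D, continuous f}.
Proof.
move=> oD H; rewrite continuous_open_subspace// => x; rewrite inE => Dx O.
rewrite nbhsE => -[B [oB Bx] sBO].
apply: (@filterS _ _ _ (D `&` f @^-1` B)) => [y [_ By]|]; first exact: sBO.
by apply: open_nbhs_nbhs; split; [exact: H|].
Qed.

Lemma is_chartK w : is_chart (chartK w).
Proof.
have Sw : S3S3 R (\val w) := set_valP w.
have od := open_cdom_chartK w; split=> //.
- by rewrite cimg_chartK; exact: openT.
- move=> p; rewrite -[p]reprK cdom_chartK cmap_chartK => h0.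
  rewrite [cinv _ _]/=; apply/pi_KP; exists (height (\val w) (\val (repr p))) => //.
  rewrite /= coordKK//; last exact: set_valP.
  by rewrite scalerA mulfV ?scale1r ?gt_eqF.
- apply: continuous_within_open => // O oO; apply/open_quotient/open_set_type.
  exists ([set x | 0 < height (\val w) x] `&` coordK (\val w) @^-1` O).
    rewrite openE => x [/= h0 Ox]; apply: filterI.
      by apply: open_nbhs_nbhs; split => //; exact: open_height.
    apply: (smooth_continuous (smooth_coordK _) h0).
    exact: open_nbhs_nbhs.
  apply/seteqP; split=> x [].
    by move=> /cdom_chartK h0 Ox; split=> //; rewrite /= -(cmap_chartK w x).
  move=> h0 Ox; split; first exact/cdom_chartK.
  by suff : O (cmap (chartK w) (\pi_(K R) x)) by []; rewrite cmap_chartK.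
- rewrite cimg_chartK; apply: continuous_subspaceT => y.
  pose f y : cone R := SigSub (mem_set (cone_paramK (set_valP w) y)).
  apply: (@continuous_comp _ _ _ f \pi_(K R)); last exact: pi_continuous.
  have cf : continuous f.
    apply/continuousP => O /open_set_type[B oB ->].
    apply: open_comp oB => z _ /=.
    apply: (smooth_continuous (U := setT)) => //.
    by apply: smooth_paramK; [exact: openT|exact: smooth_id].
  exact: cf.
Qed.

Lemma atlas_chartK w : atlasK R (chartK w).
Proof.
have Sw : S3S3 R (\val w) := set_valP w.
split; first exact: is_chartK.
move=> x /cdom_chartK h0.
have sx : smooth_at (cmap (chartK w) \o \pi_(K R)) x.
  exists (coordK (\val w)), [set x | 0 < height (\val w) x]; split=> //.
  - exact: open_height.
  - exact: smooth_coordK.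
  - by move=> y _; rewrite [RHS]cmap_chartK.
split=> //; apply/seteqP; split=> // v _.
(* Surjectivity: the line y + t v in coordinates is lifted to the cone, and the constant factor h
   makes the lift start at x. *)
set h := height _ _ in h0; pose y := coordK (\val w) (\val x).
pose l (t : R^o) : 'rV[R]_5 := y + t *: v.
pose c (t : R^o) : HH R := h *: paramK (\val w) (l t).
have sl (U : set R^o) : open U -> smooth_on U l.
  move=> oU; apply: smoothD => //; first exact: smooth_cst.
  by apply: smoothZ => //; [exact: smooth_id|exact: smooth_cst].
have cc : curve_on x 1 c ('D_1 c 0).
  have o1 : open [set t : R^o | `|t| < 1] by exact: open_norm_lt.
  split=> //.
  - apply: smoothZ => //; first exact: smooth_cst.
    by apply: smooth_paramK => //; exact: sl.
  - by move=> t _; apply: coneZ; [rewrite gt_eqF|exact: cone_paramK].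
  - rewrite /c /l scale0r addr0 coordKK//; last exact: set_valP.
    by rewrite scalerA mulfV ?scale1r ?gt_eqF.
exists ('D_1 c 0); first by exists 1, c.
rewrite (diff_at_curve (h := l) sx cc).
  apply: (@derive_expansion _ _ _ _ _ _ _ (fun=> 0)); last exact: cvg_cst.
  by move=> t; rewrite /l scaler0 addr0 scale0r addr0 addr0 (_ : t *: 1 = t)//; exact: mulr1.
move=> t z _ zE; rewrite [RHS]cmap_chartK zE coordKZ ?gt_eqF//.
by rewrite paramKK.
Qed.

Lemma chartK_cover (p : K R) : exists w, cdom (chartK w) p.
Proof.
have [w [Sw [r r0 xE]]] := Psi_surj (set_valP (repr p)).
exists (SigSub (mem_set Sw)); rewrite -[p]reprK; apply/cdom_chartK.
by rewrite xE heightZ /= height_Psi// mulr_gt0.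
Qed.

End ChartsOfK.

(** * The diffeomorphism *)

Section Diffeomorphism.
Context {R : realType}.
Implicit Types (w : S3S3 R) (x : cone R) (m : M R) (p : K R).

Definition Phihat m : K R := \pi_(K R) (PhiK (repr m)).

Lemma Phihat_pi w : Phihat (\pi_(M R) w) = \pi_(K R) (PhiK w).
Proof.
have [t e] : exists t, \val (repr (\pi_(M R) w)) = circle_act t (\val w).
  by apply/pi_MP; rewrite reprK.
apply/esym/pi_KP; exists 1 => //.
by rewrite scale1r !val_PhiK e Psi_circle.
Qed.

Lemma Phihat_inj : injective Phihat.
Proof.
move=> m m'; rewrite -[m]reprK -[m']reprK !Phihat_pi => /pi_KP[r r0].
rewrite !val_PhiK => /Psi_fiber e; apply/pi_MP; apply: e => //; exact: set_valP.
Qed.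

Lemma Phihat_surj p : exists w, Phihat (\pi_(M R) w) = p.
Proof.
have [w [Sw [r r0 e]]] := Psi_surj (set_valP (repr p)).
exists (SigSub (mem_set Sw)); rewrite Phihat_pi -[p]reprK; apply/pi_KP; exists r => //.
by rewrite val_PhiK.
Qed.

(** The preimage is picked pointwise by choice; continuity is recovered afterwards from the local
    sections [Psi_section]. *)
Definition Phihat_inv p : M R := \pi_(M R) (sval (cid (Phihat_surj p))).

Lemma Phihat_invK : cancel Phihat_inv Phihat.
Proof. by move=> p; rewrite /Phihat_inv; case: cid. Qed.

Lemma PhihatK : cancel Phihat Phihat_inv.
Proof. by move=> m; apply: Phihat_inj; rewrite Phihat_invK. Qed.

Lemma Phihat_continuous : continuous Phihat.
Proof.
apply/quotient_continuous.
have -> : Phihat \o \pi_(M R) = \pi_(K R) \o @PhiK R by apply/funext => w; exact: Phihat_pi.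
have cP : continuous (@PhiK R).
  apply/continuousP => O /open_set_type[B oB ->].
  apply/open_set_type; exists (@Psi R @^-1` B).
    apply: open_comp oB => z _.
    apply: (smooth_continuous (U := setT)) => //.
    by apply: smooth_Psi; [exact: openT|exact: smooth_id].
  by apply/seteqP; split=> w; rewrite /preimage /mkset val_PhiK.
by move=> w; apply: continuous_comp; [exact: cP|exact: pi_continuous].
Qed.

Lemma cvg_qmul {T : Type} (F : set_system T) {FF : Filter F} (f g : T -> 'rV[R]_4) a b :
  f @ F --> a -> g @ F --> b -> (fun t => qmul (f t) (g t)) @ F --> qmul a b.
Proof.
move=> fa gb; pose h (z : HH R) := qmul z.1 z.2.
have ch : h @ (a, b) --> h (a, b).
  apply: (smooth_continuous (U := setT)) => //.
  apply: smooth_qmul; first exact: openT.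
    by apply: smooth_fst; [exact: openT|exact: smooth_id].
  by apply: smooth_snd; [exact: openT|exact: smooth_id].
exact: (cvg_comp (fun t => (f t, g t)) h (cvg_pair fa gb) ch).
Qed.

Lemma qabs_continuous : continuous (@qabs R).
Proof.
move=> q; apply: continuous_comp; last exact: sqrt_continuous.
apply: (smooth_continuous (W := R^o) (U := setT)) => //.
have sc i : smooth_on [set: 'rV[R]_4] (fun y => y 0 i : R^o).
  by apply: smooth_coord; [exact: openT|exact: smooth_id].
have oT : open [set: 'rV[R]_4] by exact: openT.
by repeat first [apply: smoothD => // | apply: smoothX => //].
Qed.

Lemma Psi_section_continuous w r : 0 < r ->
  {for r *: Psi (\val w), continuous (Psi_section (\val w).1)} /\
  \forall y \near r *: Psi (\val w), section_numerator (\val w).1 y != 0.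
Proof.
move=> r0; have Sw : S3S3 R (\val w) := set_valP w.
set x := r *: Psi (\val w); have [hn0 _] := Psi_section_Psi Sw r0; rewrite -/x in hn0.
have c1 : (fun y : HH R => y.1) @ x --> x.1 by exact: cvg_fst.
have c2 : (fun y : HH R => y.2) @ x --> x.2 by exact: cvg_snd.
have cqa (f : HH R -> 'rV[R]_4) : f @ x --> f x ->
    (fun y => qabs (f y)) @ x --> qabs (f x).
  by move=> fx; exact: (cvg_comp f (@qabs R) fx (@qabs_continuous _)).
have cV (f : HH R -> R) : f x != 0 -> f @ x --> f x ->
    (fun y => (f y)^-1) @ x --> (f x)^-1.
  by move=> f0 fx; exact: cvgV.
have x10 : qabs x.1 != 0.
  rewrite gt_eqF// qabs_cone_gt0//; apply: coneZ; first by rewrite gt_eqF.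
  exact: cone_Psi.
have ci := cV _ x10 (cqa _ c1).
have ch : section_numerator (\val w).1 @ x --> section_numerator (\val w).1 x.
  apply: cvgB; first exact: cvg_cst.
  by apply: cvg_qmul; [exact: cvg_cst|exact: cvgZ].
have qn0 (q : 'rV[R]_4) : q != 0 -> qabs q != 0.
  by move=> q0; rewrite -sqrf_eq0 qabs2E qdot_eq0.
split; last by apply: cvgr_neq0 ch hn0.
have ck : (fun y => (qabs (section_numerator (\val w).1 y))^-1 *:
      section_numerator (\val w).1 y) @ x -->
    (qabs (section_numerator (\val w).1 x))^-1 *: section_numerator (\val w).1 x.
  have cn : (fun y => (qabs (section_numerator (\val w).1 y))^-1) @ x -->
      (qabs (section_numerator (\val w).1 x))^-1 by apply: cV; [exact: qn0|exact: cqa].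
  exact: cvgZ cn ch.
exact: cvg_pair ck (cvg_qmul ck (cvgZ ci c2)).
Qed.

(** If w represents the preimage of the ray of x, then near x the inverse is induced by the section
    with g = w1, which passes through w. Continuity thus reduces to that of [Psi_section] at
    [\val x]. *)
Lemma Phihat_inv_continuous : continuous Phihat_inv.
Proof.
apply/continuousP => O oO; apply/open_quotient.
rewrite openE => x /= Ox.
have [w] := Phihat_surj (\pi_(K R) x); rewrite Phihat_pi => /pi_KP[r r0].
rewrite val_PhiK => xE; have Sw : S3S3 R (\val w) := set_valP w.
have Ow : O (\pi_(M R) w).
  suff <- : Phihat_inv (\pi_(K R) x) = \pi_(M R) w by [].
  apply: Phihat_inj; rewrite Phihat_invK Phihat_pi; apply/esym/pi_KP; exists r => //.
  by rewrite val_PhiK.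
have /open_set_type[B oB BE] : open (\pi_(M R) @^-1` O) by exact/open_quotient.
have Bw : B (\val w) by have : (\pi_(M R) @^-1` O) w by []; rewrite BE.
have [cs hn0] := Psi_section_continuous w r0; rewrite -xE in cs hn0.
have sx : Psi_section (\val w).1 (\val x) = \val w.
  by rewrite xE (Psi_section_Psi Sw r0).2.
have nB : \forall y \near \val x, B (Psi_section (\val w).1 y).
  by apply: cs; apply: open_nbhs_nbhs; rewrite sx.
have cval : (\val : cone R -> HH R) @ x --> \val x by exact: initial_continuous.
have near_x : \forall y \near x, B (Psi_section (\val w).1 (\val y)) /\
    section_numerator (\val w).1 (\val y) != 0 by exact: (cval _ (filterI nB hn0)).
apply: filterS near_x => y [By hy].
have cy : cone R (\val y) := set_valP y.
have [Ss yE] := Psi_sectionP cy hy.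
pose v : S3S3 R := SigSub (mem_set Ss).
have Ov : O (\pi_(M R) v) by have : (\pi_(M R) @^-1` O) v by rewrite BE.
suff e : Phihat_inv (\pi_(K R) y) = \pi_(M R) v by rewrite -e in Ov.
apply: Phihat_inj; rewrite Phihat_invK Phihat_pi; apply/esym/pi_KP.
exists (qabs (\val y).1); first exact: qabs_cone_gt0.
by rewrite val_PhiK.
Qed.

Definition pullback (c : @chart R (K R) 5) : @chart R (M R) 5 :=
  Chart (Phihat @^-1` cdom c) (cmap c \o Phihat) (Phihat_inv \o cinv c).

Lemma cimg_pullback c : cimg (pullback c) = cimg c.
Proof.
apply/seteqP; split=> y /= [q cq <-]; first by exists (Phihat q).
by exists (Phihat_inv q); rewrite /= Phihat_invK.
Qed.

Lemma is_chart_pullback c : is_chart c -> is_chart (pullback c).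
Proof.
move=> [od oi cK cm ci].
have od' : open (Phihat @^-1` cdom c).
  by apply: open_comp od => q _; exact: Phihat_continuous.
split=> //; rewrite ?cimg_pullback//.
- by move=> q /= cq; rewrite cK// PhihatK.
- rewrite continuous_open_subspace// in cm.
  rewrite [cdom _]/= [cmap _]/= continuous_open_subspace// => q; rewrite inE => cq.
  apply: continuous_comp; first exact: Phihat_continuous.
  by apply: cm; rewrite inE.
- rewrite continuous_open_subspace// in ci.
  rewrite [cinv _]/= continuous_open_subspace// => y iy.
  apply: (@continuous_comp _ _ _ (cinv c) Phihat_inv).
    exact: (ci y iy).
  exact: Phihat_inv_continuous.
Qed.

Lemma comp_Phihat_pi (T : Type) (f : K R -> T) :
  (f \o Phihat) \o \pi_(M R) = (f \o \pi_(K R)) \o @PhiK R.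
Proof. by apply/funext => w /=; rewrite Phihat_pi. Qed.

Lemma smooth_at_PhiK (W : normedModType R) (f : cone R -> W) w :
  smooth_at f (PhiK w) -> smooth_at (f \o @PhiK R) w.
Proof.
apply: (@smooth_at_pre _ _ _ _ _ _ _ (@Psi R)).
- exact: coordinatized_HH.
- by apply: smooth_Psi; [exact: openT|exact: smooth_id].
- exact: val_PhiK.
Qed.

(** For surjectivity, a vector tangent to the cone at [Psi w] is split by
    [cone_tangent_decomposition] into a radial part and the image under [dPsi] of a vector tangent
    to S^3 x S^3. By [diff_at_ray] the latter vector already has the required image, the radial part
    being invisible in K. *)
Lemma atlas_pullback c : atlasK R c -> atlasM R (pullback c).
Proof.
move=> [icc sub]; split; first exact: is_chart_pullback.
move=> w /= cw; rewrite comp_Phihat_pi.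
have [sc surj] : smooth_at (cmap c \o \pi_(K R)) (PhiK w) /\
    diff_at (cmap c \o \pi_(K R)) (PhiK w) @` tangent_at (PhiK w) = setT.
  by apply: sub; rewrite -Phihat_pi.
have sP := smooth_at_PhiK sc; split=> //.
apply/seteqP; split=> // v _.
have [u tu <-] : (diff_at (cmap c \o \pi_(K R)) (PhiK w) @` tangent_at (PhiK w)) v.
  by rewrite surj.
have [u0] := tangent_cone tu; rewrite val_PhiK => uT.
have [al [p1 [p2 [p10 p20 uE]]]] :=
  cone_tangent_decomposition (set_valP w) u0 uT.
have vE : \val (PhiK w) = 1 *: Psi (\val w) by rewrite val_PhiK scale1r.
have [_] := diff_at_ray al ltr01 vE p10 p20 sc sP.
rewrite scale1r -uE => ->.
exists (qmul p1 (\val w).1, qmul p2 (\val w).2) => //.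
by exists 1, (rotation (\val w) p1 p2); exact: rotation_curve.
Qed.

Lemma smooth_on_eq_id n (T : topologicalType) (c : @chart R T n)
    (f : 'rV[R]_n -> 'rV[R]_n) :
  is_chart c -> (forall y, cimg c y -> f y = y) -> smooth_on (cimg c) f.
Proof.
move=> [_ oi _ _ _] fE k; apply: (@Ck_eq _ _ _ _ _ id) => //; last exact: smooth_id.
by move=> y /fE.
Qed.

Lemma cmapK n (T : topologicalType) (c : @chart R T n) y :
  is_chart c -> cimg c y -> cmap c (cinv c y) = y.
Proof. by move=> [_ _ cK _ _] [q cq <-]; rewrite cK. Qed.

Lemma Phihat_diffeomorphism : diffeomorphism (atlasM R) (atlasK R) Phihat.
Proof.
have cover p : exists c, [/\ atlasK R c, cdom c p & is_chart c].
  have [w cw] := chartK_cover p.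
  by exists (chartK w); split=> //; [exact: atlas_chartK|exact: is_chartK].
split.
  move=> m; have [c [ac cm ic]] := cover (Phihat m).
  exists (pullback c), c; split=> //.
  - by split=> //; exact: atlas_pullback.
  - by move=> _ [q cq <-].
  - rewrite cimg_pullback; apply: smooth_on_eq_id => // y iy.
    by rewrite /= Phihat_invK; exact: (cmapK ic iy).
exists Phihat_inv; split; [exact: PhihatK|exact: Phihat_invK|].
move=> p; have [c [ac cp ic]] := cover p.
exists c, (pullback c); split=> //; first exact: atlas_pullback.
- by move=> _ [q cq <-] /=; rewrite Phihat_invK.
- apply: smooth_on_eq_id => // y iy.
  by rewrite /= Phihat_invK; exact: (cmapK ic iy).
Qed.

Lemma smooth_fun_Phihat (g : K R -> R^o) :
  smooth_fun (atlasK R) g -> smooth_fun (atlasM R) (g \o Phihat).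
Proof.
move=> sg m; have [c [ac cm sc]] := sg (Phihat m).
exists (pullback c); split; [exact: atlas_pullback|by []|].
rewrite cimg_pullback.
have -> // : (g \o Phihat) \o cinv (pullback c) = g \o cinv c.
by apply/funext => y /=; rewrite Phihat_invK.
Qed.

(** Over the domain of a chart c, the composite of g with the projection is [g \o cinv c] after
    [cmap c \o \pi], which is smooth because c lies in the quotient atlas. *)
Lemma smooth_fun_pi (g : K R -> R^o) x :
  smooth_fun (atlasK R) g -> smooth_at (g \o \pi_(K R)) x.
Proof.
move=> sg; have [c [[[od oi cK _ _] sub] cx sc]] := sg (\pi_(K R) x).
have [sx _] := sub x cx.
have /open_set_type[B oB BE] : open (\pi_(K R) @^-1` cdom c) by exact/open_quotient.
have BP y : cdom c (\pi_(K R) y) <-> B (\val y).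
  by rewrite -[cdom c _]/((\pi_(K R) @^-1` cdom c) y) BE.
apply: (smooth_at_post (coordinatized_row _) sx oi _ sc oB).
- by exists (\pi_(K R) x).
- exact/BP.
- by move=> y /BP cy /=; rewrite cK.
Qed.

Lemma differential_diff_pi w x r al a b : 0 < r -> \val x = r *: Psi (\val w) ->
  differential (atlasK R) Phihat
    (diff_pi (Mquot R) 5 w (rolling_vec 3 a b (\val w))) =
  diff_pi (Kquot R) 5 x
    (al *: Psi (\val w) + r *: dPsi (\val w) (rolling_vec 3 a b (\val w))).
Proof.
move=> r0 xE; apply/funext => g; rewrite /differential /diff_pi.
(* Both sides are the default 0 on a test function that is not smooth. For a smooth g, smoothness of
   [g \o Phihat] opens the inner conditional as well. *)
case: asboolP => // sg; have := smooth_fun_Phihat sg => /asboolP ->.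
have sx := smooth_fun_pi x sg.
have sw := smooth_at_PhiK (smooth_fun_pi (PhiK w) sg).
rewrite comp_Phihat_pi rolling_vecE.
have p0 (k c d : R) : (k *: quat 0 0 c d) 0 0 = 0 by rewrite mxE quatE mulr0.
by have [_ ->] := diff_at_ray al r0 xE (quatE 0 0 a b).1.1.1 (p0 3 a b) sx sw.
Qed.

(** The direct inclusion uses the representative [PhiK w], with r = 1 and no radial part.
    Conversely, a representative x of the ray is some r [Psi w] with w representing m, and
    [zero_divisor_rolling_inv] writes each of its zero divisors as a velocity handled by
    [differential_diff_pi]. *)
Lemma Phihat_D m : differential (atlasK R) Phihat @` D 3 m = Delta (Phihat m).
Proof.
apply/seteqP; split=> [_ [v [w [<- [a [b ->]]]] <-]|v [x [xm [y Dy ->]]]].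
  exists (PhiK w); split; first by rewrite Phihat_pi.
  exists (dPsi (\val w) (rolling_vec 3 a b (\val w))).
    rewrite val_PhiK; apply: zero_divisor_rolling; exact: set_valP.
  have vE : \val (PhiK w) = 1 *: Psi (\val w) by rewrite val_PhiK scale1r.
  by rewrite (differential_diff_pi 0 _ _ ltr01 vE) scale0r add0r scale1r.
move: xm; rewrite -[m]reprK Phihat_pi => /esym/pi_KP[r r0]; rewrite val_PhiK => xE.
have [al [a [b yE]]] : exists al a b, y = al *: Psi (\val (repr m)) +
    r *: dPsi (\val (repr m)) (rolling_vec 3 a b (\val (repr m))).
  by apply: zero_divisor_rolling_inv; rewrite -?xE//; exact: set_valP.
rewrite yE -(differential_diff_pi al a b r0 xE).
exists (diff_pi (Mquot R) 5 (repr m) (rolling_vec 3 a b (\val (repr m)))) => //.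
by exists (repr m); split=> //; exists a, b.
Qed.

End Diffeomorphism.

Theorem proposition1 (R : realType) :
  exists Phihat : M R -> K R,
    [/\ forall w : S3S3 R, Phihat (\pi_(M R) w) = \pi_(K R) (PhiK w),
        diffeomorphism (atlasM R) (atlasK R) Phihat &
        forall m : M R,
          differential (atlasK R) Phihat @` D 3 m = Delta (Phihat m)].
Proof.
exists Phihat; split; [exact: Phihat_pi|exact: Phihat_diffeomorphism|].
exact: Phihat_D.
Qed.
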